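(* Fix $\beta\neq 0$ and suppose $\Delta_{\min}>0$. For any fixed $\delta\in(0,1]$, with probability at least $1-\delta$, the regret of Algorithm RSVI2 (run with inputs $K$, $\delta$, $\beta$) satisfies $$\mathcal{R}(K)\lesssim \frac{(e^{|\beta| H}-1)^2 H^3S^2A}{|\beta|^2\Delta_{\min}}\log(HSAK/\delta)^2 .$$ Moreover, for RSVI2 run with confidence parameter $\delta=1/(HK)$, the expected regret satisfies $$\mathbb{E}[\mathcal{R}(K)]\lesssim \frac{(e^{|\beta| H}-1)^2 H^3S^2A}{|\beta|^2\Delta_{\min}}\log(HSAK)^2 .$$
   Context: Episodic finite-horizon tabular MDP: finite state set $\mathcal{S}$ with $|\mathcal{S}|=S$, finite action set $\mathcal{A}$ with $|\mathcal{A}|=A$, horizon $H$, number of episodes $K$, transition kernels $\mathcal{P}_h(\cdot\mid s,a)$ for $h\in[H]$, and deterministic rewards $r_h:\mathcal{S}\times\mathcal{A}\to[0,1]$. Every episode starts at the same fixed state $s_1$; in episode $k$ at step $h$ the agent at $s_h^k$ takes $a_h^k$, receives $r_h(s_h^k,a_h^k)$ and moves to $s_{h+1}^k\sim\mathcal{P}_h(\cdot\mid s_h^k,a_h^k)$. A policy is $\pi=(\pi_h:\mathcal{S}\to\mathcal{A})_{h\in[H]}$. For risk parameter $\beta\ne0$: $V_h^\pi(s)=\frac1\beta\log\mathbb{E}[e^{\beta\sum_{i=h}^H r_i(s_i,\pi_i(s_i))}\mid s_h=s]$ and $Q_h^\pi(s,a)=\frac1\beta\log\mathbb{E}[e^{\beta\sum_{i=h}^H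 r_i(s_i,a_i)}\mid s_h=s,a_h=a]$ with $a_i=\pi_i(s_i)$ for $i>h$; $V_{H+1}^\pi\equiv 0$. $V_h^*=\sup_\pi V_h^\pi$, attained by an optimal policy $\pi^*$, and $Q_h^*=Q_h^{\pi^*}$. If the learner uses policy $\pi^k$ in episode $k$, the regret is $\mathcal{R}(K)=\sum_{k=1}^K (V_1^*-V_1^{\pi^k})(s_1)$. Trajectories: a trajectory is $\tau=((s_j,a_j))_{j\in[H]}\in(\mathcal{S}\times\mathcal{A})^H$; $\tau_h$ is its first $h$ pairs ($\tau_0$ empty); $R(\tau_0)=0$, $R(\tau_h)=\sum_{j=1}^h r_j(s_j,a_j)$. Cascaded gap: $\Delta_h(s,a;\tau_{h-1})=\psi_\beta e^{\beta R(\tau_{h-1})}[e^{\beta V_h^*(s)}-e^{\beta Q_h^*(s,a)}]$ with $\psi_\beta=1/\beta$ if $\beta>0$ and $\psi_\beta=e^{-\beta H}/\beta$ if $\beta<0$ (always $\ge0$). $\Delta_{\min}$ is the minimum of $\Delta_h(s,a;\tau_{h-1})$ over all $(h,s,a,\tau)$ for which it is nonzero. Notation $x\lesssim y$ means $x\le Cy$ for a universal constant $C>0$; $\log$ is natural. Algorithm RSVI2 (inputs $K$, $\delta\in(0,1]$, $\beta\neq0$; $c>0$ an appropriate universal constant): initialize $Q_h(s,a),V_h(s)\leftarrow H-h+1$, $w_h(s,a)\leftarrow0$, $N_h(s,a)\leftarrow0$ for all $(h,s,a)\in[H+1]\times\mathcal{S}\times\mathcal{A}$. In each episode $k=1,\dots,K$: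 for $h=H,\dots,1$ and each $(s,a)$ with $N_h(s,a)\ge1$, set $w_h(s,a)\leftarrow\frac{1}{N_h(s,a)}\sum_{i\in[k-1]}\mathbb{1}\{(s_h^i,a_h^i)=(s,a)\}e^{\beta[r_h(s,a)+V_{h+1}(s_{h+1}^i)]}$, $b_h(s,a)\leftarrow c|e^{\beta(H-h+1)}-1|\sqrt{S\log(2SAHK/\delta)/N_h(s,a)}$, $G_h(s,a)\leftarrow\min\{e^{\beta(H-h+1)},w_h(s,a)+b_h(s,a)\}$ if $\beta>0$ and $G_h(s,a)\leftarrow\max\{e^{\beta(H-h+1)},w_h(s,a)-b_h(s,a)\}$ if $\beta<0$, $Q_h(s,a)\leftarrow\frac1\beta\log G_h(s,a)$, and $V_h(s)\leftarrow\max_{a'}Q_h(s,a')$. Then for $h=1,\dots,H$: take $a_h\leftarrow\arg\max_a Q_h(s_h,a)$, observe $r_h(s_h,a_h)$ and $s_{h+1}$, and increment $N_h(s_h,a_h)$. *)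

(* Defs.v *)
From HB Require Import structures.
From mathcomp Require Import all_boot all_order all_algebra.
From mathcomp Require Import boolp classical_sets reals.
From mathcomp Require Import sequences exp.
Unset Printing Implicit Defensive.
Import Order.TTheory GRing.Theory Num.Theory.
Local Open Scope ring_scope.

(* Steps are 0-indexed: the nat step h (0 <= h < H) is the paper's step h+1.
   Transition kernels / rewards are given on all nat steps; only h < H matter. *)
Section RiskSensitiveMDP.
Variables (R : realType) (S A : finType) (H : nat)
  (P : nat -> S -> A -> S -> R) (r : nat -> S -> A -> R) (beta : R).

Definition policy := nat -> S -> A.

(* W pi n s = E[ exp(beta * sum of rewards of the remaining n steps) | s ],
   the current step being H - n, following pi (expectation over the chain). *)
Fixpoint Wpi (pi : policy) (n : nat) (s : S) : R :=
  match n with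
  | 0 => 1
  | n'.+1 =>
      let h := (H - n'.+1)%N in
      let a := pi h s in
      expR (beta * r h s a) * \sum_(s' : S) P h s a s' * Wpi pi n' s'
  end.

Definition Vpi (pi : policy) (h : nat) (s : S) : R :=
  beta^-1 * ln (Wpi pi (H - h) s).

Definition Qpi (pi : policy) (h : nat) (s : S) (a : A) : R :=
  beta^-1 * ln (expR (beta * r h s a) *
                \sum_(s' : S) P h s a s' * Wpi pi (H - h.+1) s').

Definition Vstar (h : nat) (s : S) : R := sup (range (fun pi : policy => Vpi pi h s)).
Definition Qstar (h : nat) (s : S) (a : A) : R :=
  sup (range (fun pi : policy => Qpi pi h s a)).

Definition psi_beta : R :=
  if 0 < beta then beta^-1 else expR (- beta * H%:R) / beta.

(* R(tau_{h-1}) for the paper's step h = (nat step h) + 1: rewards of the first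
   h pairs of tau. *)
Definition Rprefix (h : 'I_H) (tau : {ffun 'I_H -> S * A}) : R :=
  \sum_(j : 'I_H | (j < h)%N) r j (tau j).1 (tau j).2.

Definition Delta (h : 'I_H) (s : S) (a : A) (tau : {ffun 'I_H -> S * A}) : R :=
  psi_beta * expR (beta * Rprefix h tau) *
  (expR (beta * Vstar h s) - expR (beta * Qstar h s a)).

(* Minimum of the nonzero cascaded gaps (a finite set, so inf = min). *)
Definition Delta_min : R :=
  inf [set d | exists (h : 'I_H) (s : S) (a : A) (tau : {ffun 'I_H -> S * A}),
                 d = Delta h s a tau /\ d != 0].

Variables (s1 : S) (c : R) (K : nat) (delta : R).

(* An episode record: step h |-> ((s_h, a_h), s_{h+1}). *)
Definition episode := nat -> S * A * S.

Definition Ncount (hist : seq episode) (h : nat) (s : S) (a : A) : nat :=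
  count (fun e : episode => (e h).1 == (s, a)) hist.

Definition walg (hist : seq episode) (h : nat) (Vn : S -> R) (s : S) (a : A) : R :=
  (Ncount hist h s a)%:R^-1 *
  \sum_(e <- hist | (e h).1 == (s, a)) expR (beta * (r h s a + Vn (e h).2)).

Definition bonus (h : nat) (N : nat) : R :=
  c * `|expR (beta * (H - h)%:R) - 1| *
  Num.sqrt (#|S|%:R * ln (2 * #|S|%:R * #|A|%:R * H%:R * K%:R / delta) / N%:R).

Definition Galg (hist : seq episode) (h : nat) (Vn : S -> R) (s : S) (a : A) : R :=
  if 0 < beta then
    Num.min (expR (beta * (H - h)%:R)) (walg hist h Vn s a + bonus h (Ncount hist h s a))
  else
    Num.max (expR (beta * (H - h)%:R)) (walg hist h Vn s a - bonus h (Ncount hist h s a)).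

(* Q_h(s,a) computed from V_{h+1} = Vn; unvisited pairs keep their initial
   value H - h + 1 (paper indexing). *)
Definition Qstep (hist : seq episode) (h : nat) (Vn : S -> R) (s : S) (a : A) : R :=
  if Ncount hist h s a == 0%N then (H - h)%:R
  else beta^-1 * ln (Galg hist h Vn s a).

Definition maxA (f : A -> R) : R := sup (range f).

(* Valg hist n = the algorithm's V at nat step H - n (n remaining steps);
   Valg hist 0 = V_{H+1} = 0. *)
Fixpoint Valg (hist : seq episode) (n : nat) : S -> R :=
  match n with
  | 0 => fun _ => 0
  | n'.+1 => fun s => maxA (fun a => Qstep hist (H - n'.+1) (Valg hist n') s a)
  end.

Definition Qalg (hist : seq episode) (h : nat) (s : S) (a : A) : R :=
  Qstep hist h (Valg hist (H - h.+1)) s a.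

Definition alg_policy (tb : (A -> R) -> A) (hist : seq episode) : policy :=
  fun h s => tb (fun a => Qalg hist h s a).

(* One episode played with policy pol when the successive next-states are ns
   (ns_h = s_{h+1}); s_1 is fixed. *)
Definition play (pol : policy) (ns : seq S) : episode :=
  fun h => let st := if h is h'.+1 then nth s1 ns h' else s1 in
           (st, pol h st, nth s1 ns h).

Definition run (tb : (A -> R) -> A) (nsq : seq (seq S)) : seq episode :=
  foldl (fun hist ns => rcons hist (play (alg_policy tb hist) ns)) [::] nsq.

(* Outcome space: for each of the K episodes, the H sampled next-states. *)
Definition outcome := K.-tuple (H.-tuple S).
Definition nseqs (w : outcome) : seq (seq S) := [seq val x | x <- val w].

(* Probability of an outcome (chain rule). *)
Definition prob (tb : (A -> R) -> A) (w : outcome) : R :=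
  \prod_(e <- run tb (nseqs w)) \prod_(h < H) P h (e h).1.1 (e h).1.2 (e h).2.

Definition regret (tb : (A -> R) -> A) (w : outcome) : R :=
  \sum_(k < K) (Vstar 0 s1 - Vpi (alg_policy tb (take k (run tb (nseqs w)))) 0 s1).

Definition Pr_event (tb : (A -> R) -> A) (E : pred outcome) : R :=
  \sum_(w : outcome | E w) prob tb w.

Definition Expect (tb : (A -> R) -> A) (X : outcome -> R) : R :=
  \sum_(w : outcome) prob tb w * X w.

End RiskSensitiveMDP.

(* Main.v *)
Require Import Defs.
From HB Require Import structures.
From mathcomp Require Import all_boot all_order all_algebra.
From mathcomp Require Import boolp classical_sets reals.
From mathcomp Require Import sequences exp.
From mathcomp Require Import ring lra zify.
Import Order.TTheory GRing.Theory Num.Theory.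
Local Open Scope ring_scope.

(* Everything is done in the exponential domain E = e^(beta V), multiplied by the sign of
   beta so that both cases read alike.  On the event that all empirical transition
   laws are close to the true ones, the surpluses of the optimistic values lie in
   [0, 2 bonus], so in an episode the optimistic loss is at most the expected sum of the
   u(N_h(s_h, a_h)), where u(n) = O(1 / sqrt n).  At the first suboptimal action of the
   episode the loss is at least gap_min; since u <= u^2 / (4 eps) + eps with
   eps = gap_min / (2 H), half of the loss is absorbed, and the regret of the episode is at most
   O(H / gap_min) times the expected sum of the u^2, which is O(1 / n): summing over
   the visits gives a logarithm by pigeonhole.  The concentration of the transition laws
   and the passage from expected to realised sums are both exponential supermartingale
   bounds, handled by one Markov inequality for the sum of all these supermartingales. *)

(** * Elementary inequalities for [expR] and [ln], and deviations of means *)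

Section RealInequalities.
Variable R : realType.
Implicit Types x y : R.

(** After multiplication by [1 - x <= expR (- x)] it remains to see that [(1 + x + 2 x^2) (1 - x) =
    1 + x^2 (1 - 2 x)] is at least 1, and this is where [x <= 1/2] enters. *)
Lemma expR_le_quad x : x <= 2^-1 -> expR x <= 1 + x + 2 * x ^+ 2.
Proof.
move=> hx.
have h1 : 1 - x <= expR (- x) by exact: expR_ge1Dx.
have p1 : 0 < 1 - x by lra.
have e1 : expR x * expR (- x) = 1 by rewrite -expRD subrr expR0.
have : expR x * (1 - x) <= (1 + x + 2 * x ^+ 2) * (1 - x).
  apply: (@le_trans _ _ 1); first by rewrite -[X in _ <= X]e1 ler_wpM2l ?expR_ge0.
  have : 0 <= x ^+ 2 * (1 - 2 * x) by rewrite mulr_ge0 ?sqr_ge0//; lra.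
  lra.
by rewrite ler_pM2r.
Qed.

(** Same method, with [(1 - x / 2) (1 + x) = 1 + x (1 - x) / 2 >= 1]. *)
Lemma expRN_le_half x : 0 <= x <= 1 -> expR (- x) <= 1 - x / 2.
Proof.
move=> /andP[x0 x1].
have h1 : 1 + x <= expR x by exact: expR_ge1Dx.
have p1 : 0 < 1 + x by lra.
have e1 : expR x * expR (- x) = 1 by rewrite -expRD subrr expR0.
have : expR (- x) * (1 + x) <= (1 - x / 2) * (1 + x).
  apply: (@le_trans _ _ 1); first by rewrite -[X in _ <= X]e1 [X in _ <= X]mulrC ler_wpM2l ?expR_ge0.
  have : 0 <= x * (1 - x) by rewrite mulr_ge0//; lra.
  lra.
by rewrite ler_pM2r.
Qed.

Lemma ln2_ge_half : 2^-1 <= ln 2 :> R.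
Proof.
rewrite -ler_expR lnK ?posrE//.
(* At 1/2 the quadratic bound is exactly 2. *)
by apply: (le_trans (expR_le_quad _ (lexx _))); lra.
Qed.

Lemma lnB_le x y : 0 < y -> 0 < x -> ln x - ln y <= (x - y) / y.
Proof.
move=> y0 x0; rewrite -ln_div ?posrE//.
have -> : x / y = 1 + (x - y) / y by field; apply: lt0r_neq0.
apply: le_ln1Dx; rewrite mulrBl divff ?gt_eqF//.
by rewrite ltrBrDr addrC subrr divr_gt0.
Qed.

Lemma ler_ln_wpos x y : 0 < x -> x <= y -> ln x <= ln y.
Proof. by move=> x0 xy; rewrite ler_ln ?posrE// (lt_le_trans x0). Qed.

Lemma lnXn_nat (n : nat) x : 0 < x -> ln (x ^+ n) = n%:R * ln x.
Proof. by move=> x0; rewrite lnXn// mulr_natl. Qed.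

Lemma harmonic_le (n : nat) : (0 < n)%N ->
  \sum_(i < n) i.+1%:R^-1 <= 1 + ln n%:R :> R.
Proof.
case: n => // n _; elim: n => [|n IH]; first by rewrite big_ord1 ln1 addr0 invr1.
rewrite big_ord_recr /=.
apply: le_trans (lerD IH (lexx _)) _; rewrite -addrA lerD2l.
have p1 : 0 < n.+1%:R :> R by rewrite ltr0n.
have p2 : 0 < n.+2%:R :> R by rewrite ltr0n.
have := @lnB_le n.+1%:R n.+2%:R p2 p1.
have -> : (n.+1%:R - n.+2%:R) / n.+2%:R = - n.+2%:R^-1 :> R.
  by rewrite -[X in n.+1%:R - X](natr1 n.+1) opprD addrA subrr sub0r mulN1r.
by move: (ln _) (ln _) (_^-1) => a b d; lra.
Qed.

Lemma amgm x y : 0 < y -> x <= x ^+ 2 / (4 * y) + y.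
Proof.
move=> y0; have : 0 <= (x - 2 * y) ^+ 2 / (4 * y) by rewrite divr_ge0 ?sqr_ge0//; lra.
have -> : (x - 2 * y) ^+ 2 / (4 * y) = x ^+ 2 / (4 * y) - x + y.
  by field; rewrite gt_eqF.
by lra.
Qed.

(* Only one-sided deviations are needed: a set bounds the negative part through its complement. *)
Lemma mass_deviation (T : finType) (p q f : T -> R) (lo hi d : R) :
  \sum_t p t = 1 -> \sum_t q t = 1 -> (forall t, lo <= f t <= hi) ->
  (forall U : {set T}, \sum_(t in U) p t - \sum_(t in U) q t <= d) ->
  `|\sum_t p t * f t - \sum_t q t * f t| <= (hi - lo) * d.
Proof.
move=> p1 q1 fb hU.
suff main (g : T -> R) l u : (forall t, l <= g t <= u) ->
    \sum_t p t * g t - \sum_t q t * g t <= (u - l) * d.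
  rewrite ler_norml; apply/andP; split; last exact: main.
  have fN t : - hi <= - f t <= - lo by have := fb t; rewrite !lerN2 andbC.
  have eN (s : T -> R) : \sum_t s t * - f t = - \sum_t s t * f t.
    by rewrite -sumrN; apply: eq_bigr => t _; rewrite mulrN.
  by have := main _ _ _ fN; rewrite !eN; lra.
move=> gb.
have ul : 0 <= u - l.
  have : exists t : T, true.
    apply: contrapT => nt; move: p1; rewrite big1 => [/eqP|t _]; last by case: nt; exists t.
    by rewrite eq_sym oner_eq0.
  by case=> t _; have /andP[a b] := gb t; rewrite subr_ge0 (le_trans a b).
(* Both masses are 1, so shifting [g] by a constant is free. *)
have -> : \sum_t p t * g t - \sum_t q t * g t = \sum_t (p t - q t) * (g t - l).
  under [RHS]eq_bigr do rewrite mulrBr mulrBl [(p _ - q _) * l]mulrBl.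
  by rewrite !sumrB -!mulr_suml p1 q1; lra.
pose U := [set t | q t <= p t]%SET.
apply: (@le_trans _ _ (\sum_(t in U) (u - l) * (p t - q t))).
  rewrite [X in _ <= X]big_mkcond /=; apply: ler_sum => t _.
  have /andP[a b] := gb t.
  rewrite inE; case: (lerP (q t) (p t)) => h.
    by rewrite [X in _ <= X]mulrC ler_wpM2l ?subr_ge0// lerD2r.
  by rewrite mulr_le0_ge0// ?subr_ge0// subr_le0 ltW.
by rewrite -mulr_sumr sumrB ler_wpM2l.
Qed.

End RealInequalities.

(** * Law of an episode and of a learning run *)

Section SumTuple.
Variables (V : nmodType) (T : finType).

(** Steps of an episode are peeled off at the front and episodes of a run at the back, hence this
    lemma and the next. *)
Lemma sum_tuple_cons m (F : seq T -> V) :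
  \sum_(x : m.+1.-tuple T) F x = \sum_t \sum_(x : m.-tuple T) F (t :: x).
Proof.
rewrite pair_big /= (reindex (fun p : T * m.-tuple T => cons_tuple p.1 p.2)) //=.
exists (fun x => (thead x, behead_tuple x)) => [[t x] _ | x _] /=.
  by congr (_, _); apply: val_inj.
by case/tupleP: x => t x; apply: val_inj.
Qed.

Lemma sum_tuple_rcons m (F : seq T -> V) :
  \sum_(x : m.+1.-tuple T) F x = \sum_(x : m.-tuple T) \sum_t F (rcons x t).
Proof.
elim: m F => [|m IH] F; rewrite sum_tuple_cons.
  by rewrite exchange_big; apply: eq_bigr => x _; rewrite (tuple0 x).
under eq_bigr => t _ do rewrite (IH (fun x => F (t :: x))).
by rewrite (sum_tuple_cons _ (fun x => \sum_t F (rcons x t))).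
Qed.

End SumTuple.

Section EpisodeLaw.
Variables (R : realType) (S A : finType) (H : nat) (P : nat -> S -> A -> S -> R).
Hypothesis P_ge0 : forall h s a s', (h < H)%N -> 0 <= P h s a s'.
Hypothesis P_sum1 : forall h s a, (h < H)%N -> \sum_s' P h s a s' = 1.
Variable s1 : S.
Implicit Type pol : policy S A.

(* Probability of the next states [x] over steps h0, ..., h0 + m - 1 from [s]; the default [s1]
   of [nth] is never reached when [size x = m]. *)
Definition path_weight pol (h0 m : nat) (s : S) (x : seq S) : R :=
  \prod_(j < m) P (h0 + j) (nth s1 (s :: x) j) (pol (h0 + j)%N (nth s1 (s :: x) j))
                  (nth s1 x j).

(** Ordinary (risk-neutral) policy evaluation of the costs [f], by the number [n] of remaining steps
    as in [Wpi]; [path_additive] identifies it with an expectation over paths. *)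
Fixpoint additive_value pol (f : nat -> S -> R) (n : nat) (s : S) : R :=
  match n with
  | 0 => 0
  | n'.+1 => let h := (H - n'.+1)%N in
      f h s + \sum_s' P h s (pol h s) s' * additive_value pol f n' s'
  end.

Lemma path_weight_cons pol h0 m s s' x :
  path_weight pol h0 m.+1 s (s' :: x)
    = P h0 s (pol h0 s) s' * path_weight pol h0.+1 m s' x.
Proof.
rewrite /path_weight big_ord_recl /= addn0; congr (_ * _).
by apply: eq_bigr => j _; rewrite /= /bump /= add1n addnS addSn.
Qed.

Lemma sum_path_cons pol h0 m s (X : seq S -> R) :
  \sum_(x : m.+1.-tuple S) path_weight pol h0 m.+1 s x * X x =
  \sum_s' P h0 s (pol h0 s) s' *
     \sum_(x : m.-tuple S) path_weight pol h0.+1 m s' x * X (s' :: x).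
Proof.
rewrite (sum_tuple_cons _ _ _ (fun x => path_weight pol h0 m.+1 s x * X x)).
apply: eq_bigr => s' _; rewrite mulr_sumr; apply: eq_bigr => x _.
by rewrite path_weight_cons mulrA.
Qed.

Lemma sum_path_nil pol h0 s (X : seq S -> R) :
  \sum_(x : 0.-tuple S) path_weight pol h0 0 s x * X x = X [::].
Proof.
rewrite (bigD1 [tuple]) //= big1 => [|x]; last by rewrite (tuple0 x).
by rewrite /path_weight big_ord0 mul1r addr0.
Qed.

Lemma path_weight_ge0 pol h0 m s x :
  (h0 + m <= H)%N -> 0 <= path_weight pol h0 m s x.
Proof.
move=> hm; apply: prodr_ge0 => j _; apply: P_ge0.
by apply: leq_trans hm; rewrite ltn_add2l.
Qed.

Lemma path_weight_sum1 pol h0 m s : (h0 + m <= H)%N ->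
  \sum_(x : m.-tuple S) path_weight pol h0 m s x = 1.
Proof.
under eq_bigr do rewrite -[path_weight _ _ _ _ _]mulr1.
elim: m h0 s => [|m IH] h0 s hm; first by rewrite (sum_path_nil _ _ _ (fun=> 1)).
rewrite (sum_path_cons _ _ _ _ (fun=> 1)).
under eq_bigr => s' _ do rewrite IH ?addSn -?addnS// mulr1.
by apply: P_sum1; apply: leq_trans hm; rewrite addnS ltnS leq_addr.
Qed.

(** Backward induction: the cost of the first state leaves the sum because the remaining path
    weights have total mass 1. *)
Lemma path_additive pol f h0 m s : (h0 + m = H)%N ->
  \sum_(x : m.-tuple S) path_weight pol h0 m s x *
     \sum_(j < m) f (h0 + j)%N (nth s1 (s :: x) j) = additive_value pol f m s.
Proof.
elim: m h0 s => [|m IH] h0 s hm.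
  by rewrite (sum_path_nil _ _ _ (fun x => \sum_(j < 0) f (h0 + j)%N (nth s1 (s :: x) j))) big_ord0.
rewrite (sum_path_cons _ _ _ _ (fun x => \sum_(j < m.+1) f (h0 + j)%N (nth s1 (s :: x) j))).
have hh : (H - m.+1 = h0)%N by rewrite -hm addnK.
have hlt : (h0 < H)%N by rewrite -hm addnS ltnS leq_addr.
have hm' : (h0.+1 + m = H)%N by rewrite addSn -addnS.
rewrite /= hh -[X in X + _]mulr1 -(P_sum1 h0 s (pol h0 s) hlt) mulr_sumr -big_split /=.
apply: eq_bigr => s' _.
under eq_bigr => x _.
  rewrite big_ord_recl /= addn0 mulrDr.
  under eq_bigr => j _ do rewrite /bump /= add1n addnS -addSn.
  over.
rewrite big_split /= -mulr_suml path_weight_sum1 ?hm'// mul1r IH//.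
by rewrite mulrDr [_ * f _ _]mulrC.
Qed.

(** Factors of conditional mean at most 1 multiply to a supermartingale: integrate the steps out
    from the last one backwards. *)
Lemma path_prod_le1 pol (g : nat -> S -> S -> R) h0 m s :
  (forall h s s', 0 <= g h s s') ->
  (forall h s, (h < H)%N -> \sum_s' P h s (pol h s) s' * g h s s' <= 1) ->
  (h0 + m <= H)%N ->
  \sum_(x : m.-tuple S) path_weight pol h0 m s x *
     \prod_(j < m) g (h0 + j)%N (nth s1 (s :: x) j) (nth s1 x j) <= 1.
Proof.
move=> g0 g1; elim: m h0 s => [|m IH] h0 s hm.
  by rewrite (sum_path_nil _ _ _ (fun x => \prod_(j < 0) g (h0 + j)%N (nth s1 (s :: x) j) (nth s1 x j))) big_ord0.
rewrite (sum_path_cons _ _ _ _ (fun x => \prod_(j < m.+1) g (h0 + j)%N (nth s1 (s :: x) j) (nth s1 x j))).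
have hlt : (h0 < H)%N by apply: leq_trans hm; rewrite addnS ltnS leq_addr.
apply: le_trans (g1 h0 s hlt); apply: ler_sum => s' _.
rewrite ler_wpM2l ?P_ge0//.
under eq_bigr => x _.
  rewrite big_ord_recl /= addn0 mulrCA.
  under eq_bigr => j _ do rewrite /bump /= add1n addnS -addSn.
  over.
rewrite -mulr_sumr -[X in _ <= X]mulr1 ler_wpM2l//.
by apply: IH; rewrite addSn -addnS.
Qed.

End EpisodeLaw.

(** * Law of a learning run, episode by episode *)

Section Learner.
Variables (R : realType) (S A : finType) (H : nat) (P : nat -> S -> A -> S -> R).
Hypothesis P_ge0 : forall h s a s', (h < H)%N -> 0 <= P h s a s'.
Hypothesis P_sum1 : forall h s a, (h < H)%N -> \sum_s' P h s a s' = 1.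
Variables (s1 : S) (alg : seq (episode S A) -> policy S A).

Let pw := @path_weight R S A P s1.

(** For an arbitrary map [alg] from histories to policies; [run] is the instance where [alg] is
    [alg_policy]. *)
Definition learner_run (nsq : seq (seq S)) : seq (episode S A) :=
  foldl (fun hist ns => rcons hist (play S A s1 (alg hist) ns)) [::] nsq.

Definition samples m (w : m.-tuple (H.-tuple S)) : seq (seq S) :=
  [seq val x | x <- val w].

Definition history_weight (hist : seq (episode S A)) : R :=
  \prod_(e <- hist) \prod_(h < H) P h (e h).1.1 (e h).1.2 (e h).2.

(** The increment [phi] sees the strict past and the current episode. The default [e0] is never
    reached, as [i < size hist]. *)
Definition history_sum (e0 : episode S A) (phi : seq (episode S A) -> episode S A -> R) hist : R :=
  \sum_(i < size hist) phi (take i hist) (nth e0 hist i).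

Lemma history_sum_rcons e0 phi hist e :
  history_sum e0 phi (rcons hist e) = history_sum e0 phi hist + phi hist e.
Proof.
rewrite /history_sum size_rcons big_ord_recr /= nth_rcons ltnn eqxx.
rewrite -cats1 take_size_cat//; congr (_ + _); apply: eq_bigr => i _.
by rewrite takel_cat 1?ltnW// nth_cat ltn_ord.
Qed.

Lemma learner_run_rcons nsq ns :
  learner_run (rcons nsq ns) =
  rcons (learner_run nsq) (play S A s1 (alg (learner_run nsq)) ns).
Proof. by rewrite /learner_run foldl_rcons. Qed.

Lemma size_learner_run nsq : size (learner_run nsq) = size nsq.
Proof.
by elim/last_ind: nsq => // l x IH; rewrite learner_run_rcons !size_rcons IH.
Qed.

Lemma playE pol ns h :
  play S A s1 pol ns h = (nth s1 (s1 :: ns) h, pol h (nth s1 (s1 :: ns) h), nth s1 ns h).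
Proof. by case: h. Qed.

Lemma play_weight pol ns :
  \prod_(h < H) P h (play S A s1 pol ns h).1.1 (play S A s1 pol ns h).1.2
                    (play S A s1 pol ns h).2 = pw pol 0 H s1 ns.
Proof. by apply: eq_bigr => h _; rewrite playE /= add0n. Qed.

(** Tower property: given the first [m] episodes, the next one has the path law of the policy chosen
    from them. *)
Lemma expect_rcons m (F : seq (episode S A) -> R) :
  \sum_(w : m.+1.-tuple (H.-tuple S))
     history_weight (learner_run (samples _ w)) * F (learner_run (samples _ w)) =
  \sum_(w : m.-tuple (H.-tuple S)) let hist := learner_run (samples _ w) in
     history_weight hist *
     \sum_(x : H.-tuple S) pw (alg hist) 0 H s1 x * F (rcons hist (play S A s1 (alg hist) x)).
Proof.
rewrite (sum_tuple_rcons _ _ _ (fun l : seq (H.-tuple S) =>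
  history_weight (learner_run [seq val x | x <- l]) * F (learner_run [seq val x | x <- l]))).
apply: eq_bigr => w _ /=; rewrite mulr_sumr; apply: eq_bigr => x _.
rewrite map_rcons learner_run_rcons {1}/history_weight big_rcons /=.
by rewrite play_weight -mulrA.
Qed.

Lemma history_weight_ge0 hist : 0 <= history_weight hist.
Proof. by apply: prodr_ge0 => e _; apply: prodr_ge0 => h _; apply: P_ge0. Qed.

Lemma samples0 (w : 0.-tuple (H.-tuple S)) : samples _ w = [::].
Proof. by rewrite (tuple0 w). Qed.

Lemma history_weight_sum1 m :
  \sum_(w : m.-tuple (H.-tuple S)) history_weight (learner_run (samples _ w)) = 1.
Proof.
under eq_bigr do rewrite -[history_weight _]mulr1.
elim: m => [|m IH].
  rewrite (bigD1 [tuple]) //= big1 => [|w]; last by rewrite (tuple0 w).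
  by rewrite samples0 /history_weight big_nil mulr1 addr0.
rewrite (expect_rcons _ (fun=> 1)) -[RHS]IH; apply: eq_bigr => w _ /=.
by under eq_bigr do rewrite mulr1; rewrite (path_weight_sum1 _ _ _ H _ P_sum1).
Qed.

(** By [expect_rcons] the factor of the last episode has conditional mean at most 1, so it can be
    removed. *)
Lemma exp_supermartingale e0 phi m :
  (forall hist, \sum_(x : H.-tuple S) pw (alg hist) 0 H s1 x *
                    expR (phi hist (play S A s1 (alg hist) x)) <= 1) ->
  \sum_(w : m.-tuple (H.-tuple S)) history_weight (learner_run (samples _ w)) *
     expR (history_sum e0 phi (learner_run (samples _ w))) <= 1.
Proof.
move=> hphi; elim: m => [|m IH].
  rewrite (bigD1 [tuple]) //= big1 => [|w]; last by rewrite (tuple0 w).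
  by rewrite samples0 /history_weight /history_sum big_nil big_ord0 expR0 mulr1 addr0.
rewrite (expect_rcons _ (fun hist => expR (history_sum e0 phi hist))).
apply: le_trans IH; apply: ler_sum => w _ /=.
rewrite ler_wpM2l ?history_weight_ge0//.
under eq_bigr => x _ do rewrite history_sum_rcons expRD mulrCA.
by rewrite -mulr_sumr -[X in _ <= X]mulr1 ler_wpM2l ?expR_ge0.
Qed.

End Learner.

(** * Planning in the exponential domain *)

Section Planning.
Variables (R : realType) (S A : finType) (H : nat) (P : nat -> S -> A -> S -> R)
  (r : nat -> S -> A -> R) (beta : R) (tb : (A -> R) -> A).
Hypothesis beta0 : beta != 0.
Hypothesis P_ge0 : forall h s a s', (h < H)%N -> 0 <= P h s a s'.
Hypothesis P_sum1 : forall h s a, (h < H)%N -> \sum_s' P h s a s' = 1.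
Hypothesis r01 : forall h s a, (h < H)%N -> 0 <= r h s a <= 1.
Hypothesis tbP : forall (f : A -> R) (a : A), f a <= f (tb f).

Let sg : R := Num.sg beta.

(* Multiplying by the sign of [beta] makes [V |-> sg * expR (beta * V)] increasing. *)
Definition exp_range (n : nat) (x : R) := sg <= sg * x <= sg * expR (beta * n%:R).

Lemma sg_expR (x y : R) : (sg * expR (beta * x) <= sg * expR (beta * y)) = (x <= y).
Proof.
rewrite /sg; case: (ltgtP beta 0) beta0 => // hb _.
  by rewrite ltr0_sg// !mulN1r lerN2 ler_expR ler_nM2l.
by rewrite gtr0_sg// !mul1r ler_expR ler_pM2l.
Qed.

Lemma sg_expR_ge1 (x : R) : 0 <= x -> sg <= sg * expR (beta * x).
Proof. by move=> x0; rewrite -[X in X <= _]mulr1 -expR0 -(mulr0 beta) sg_expR. Qed.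

(** The range is the interval between 1 and [expR (beta * n%:R)], whose order depends on the sign of
    [beta]; both ends are positive. *)
Lemma exp_range_gt0 n x : exp_range n x -> 0 < x.
Proof.
move=> /andP[]; rewrite /sg; case: (ltgtP beta 0) beta0 => // hb _.
  rewrite ltr0_sg// !mulN1r !lerN2 => _; apply: lt_le_trans; exact: expR_gt0.
by rewrite gtr0_sg// !mul1r => h _; apply: lt_le_trans h.
Qed.

Lemma exp_range_step h s a n x : (h < H)%N -> exp_range n x ->
  exp_range n.+1 (expR (beta * r h s a) * x).
Proof.
move=> hH hx; have x0 := exp_range_gt0 _ _ hx; move/andP: hx => [h1 h2].
have /andP[r0 r1] := r01 h s a hH.
have e0 := expR_gt0 (beta * r h s a).
apply/andP; split.
  apply: (le_trans (sg_expR_ge1 _ r0)).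
  by rewrite mulrCA [X in X <= _]mulrC ler_pM2l.
rewrite mulrCA; apply: (@le_trans _ _ (expR (beta * r h s a) * (sg * expR (beta * n%:R)))).
  by rewrite ler_pM2l.
by rewrite mulrCA -expRD -mulrDr sg_expR -natr1 addrC lerD2l.
Qed.

(** Bellman operator for [E = e^(beta V)]: rewards become factors and the operator is linear in
    [E]. *)
Definition bellman (h : nat) (E : S -> R) (s : S) (a : A) : R :=
  expR (beta * r h s a) * \sum_(s' : S) P h s a s' * E s'.

Lemma mean_exp_range (p : S -> R) n (E : S -> R) :
  (forall s, 0 <= p s) -> \sum_s p s = 1 ->
  (forall s, exp_range n (E s)) -> exp_range n (\sum_s p s * E s).
Proof.
move=> p0 p1 hE; apply/andP; split.
  rewrite -[X in X <= _]mulr1 -p1 !mulr_sumr; apply: ler_sum => s _.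
  have /andP[h1 _] := hE s.
  by rewrite mulrCA [X in X <= _]mulrC ler_wpM2l.
rewrite -[X in _ <= X]mulr1 -[X in _ <= _ * X]p1 !mulr_sumr; apply: ler_sum => s _.
have /andP[_ h1] := hE s.
by rewrite mulrCA [X in _ <= X]mulrC ler_wpM2l.
Qed.

Lemma bellman_exp_range h s a n E : (h < H)%N ->
  (forall s', exp_range n (E s')) -> exp_range n.+1 (bellman h E s a).
Proof. by move=> hH hE; apply: exp_range_step => //; apply: mean_exp_range => // *; [apply: P_ge0|apply: P_sum1]. Qed.

Lemma bellmanB h E E' s a :
  bellman h E s a - bellman h E' s a =
  expR (beta * r h s a) * \sum_s' P h s a s' * (E s' - E' s').
Proof.
rewrite /bellman -mulrBr -sumrB; congr (_ * _).
by apply: eq_bigr => s' _; rewrite mulrBr.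
Qed.

Lemma bellman_mono h E E' s a : (h < H)%N ->
  (forall s', sg * E s' <= sg * E' s') ->
  sg * bellman h E s a <= sg * bellman h E' s a.
Proof.
move=> hH hE; rewrite -subr_ge0 -mulrBr bellmanB mulrCA mulr_ge0 ?expR_ge0//.
rewrite mulr_sumr sumr_ge0// => s' _.
by rewrite mulrCA mulr_ge0 ?P_ge0// mulrBr subr_ge0.
Qed.

(** For [beta < 0] maximising [V] means minimising [e^(beta V)], hence the sign. The tie-breaking
    rule [tb] of the learner serves as the arg max here as well. *)
Fixpoint Wopt (n : nat) (s : S) : R :=
  match n with
  | 0 => 1
  | n'.+1 => let F := bellman (H - n'.+1) (Wopt n') s in F (tb (fun a => sg * F a))
  end.

Definition pi_opt : policy S A :=
  fun h s => tb (fun a => sg * bellman h (Wopt (H - h.+1)) s a).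

Local Notation W := (Wpi R S A H P r beta).

Lemma subn_ltH n : (n < H)%N -> (H - n.+1 < H)%N.
Proof. by move=> nH; rewrite ltn_subrL (leq_trans _ nH). Qed.

Lemma subn_subnS n : (n < H)%N -> (H - (H - n.+1).+1)%N = n.
Proof. by move=> nH; rewrite subnSK// subKn// ltnW. Qed.

Lemma Wpi_pi_opt n s : (n <= H)%N -> W pi_opt n s = Wopt n s.
Proof.
elim: n s => [//|n IH] s nH /=.
rewrite {1 2}/pi_opt subn_subnS// /bellman; congr (_ * _).
by apply: eq_bigr => s' _; rewrite IH ?(ltnW nH)// /pi_opt subn_subnS.
Qed.

Lemma bellman_le_Wopt n s a : (n < H)%N ->
  sg * bellman (H - n.+1) (Wopt n) s a <= sg * Wopt n.+1 s.
Proof. by move=> nH /=; apply: (tbP (fun a => sg * bellman (H - n.+1) (Wopt n) s a)). Qed.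

(** Replace the continuation by the optimal one by monotonicity, then the action by the greedy
    one. *)
Lemma Wpi_le_Wopt pi n s : (n <= H)%N -> sg * W pi n s <= sg * Wopt n s.
Proof.
elim: n s => [//|n IH] s nH.
apply: le_trans (bellman_le_Wopt _ _ (pi (H - n.+1)%N s) nH).
by apply: (bellman_mono (H - n.+1)%N (W pi n)) => [|s']; rewrite ?subn_ltH// IH// ltnW.
Qed.

Lemma Wpi_exp_range pi n s : (n <= H)%N -> exp_range n (W pi n s).
Proof.
elim: n s => [|n IH] s nH /=; first by rewrite /exp_range mulr0 expR0 mulr1 lexx.
by apply: bellman_exp_range => [|s']; rewrite ?subn_ltH// IH// ltnW.
Qed.

Lemma Wopt_exp_range n s : (n <= H)%N -> exp_range n (Wopt n s).
Proof. by move=> nH; rewrite -Wpi_pi_opt//; apply: Wpi_exp_range. Qed.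

Lemma ln_sg (x y : R) : 0 < x -> 0 < y -> sg * x <= sg * y ->
  beta^-1 * ln x <= beta^-1 * ln y.
Proof.
move=> x0 y0; rewrite -[in X in X -> _](lnK x0) -[in X in X -> _](lnK y0).
have e z : z = beta * (beta^-1 * z) by rewrite mulVKf.
by rewrite [ln x in X in X -> _]e [ln y in X in X -> _]e sg_expR.
Qed.

Lemma expR_ln_sg (x : R) : 0 < x -> expR (beta * (beta^-1 * ln x)) = x.
Proof. by move=> x0; rewrite mulVKf// lnK. Qed.

Lemma sup_policies (F : policy S A -> R) (pi0 : policy S A) :
  (forall pi, F pi <= F pi0) -> sup (range F) = F pi0.
Proof.
move=> hF; apply/le_anti/andP; split.
  by apply: ge_sup => [|_ [pi _ <-]//]; exists (F pi0), pi0.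
by apply: ub_le_sup; [exists (F pi0) => _ [pi _ <-]|exists pi0].
Qed.

Lemma VstarE h s : Vstar R S A H P r beta h s = Vpi R S A H P r beta pi_opt h s.
Proof.
apply: sup_policies => pi; have hH := leq_subr h H.
apply: ln_sg; try exact: exp_range_gt0 (Wpi_exp_range _ _ _ hH).
by rewrite (Wpi_pi_opt _ _ hH) Wpi_le_Wopt.
Qed.

Lemma expR_Vpi pi h s : expR (beta * Vpi R S A H P r beta pi h s) = W pi (H - h) s.
Proof. by rewrite expR_ln_sg//; apply: exp_range_gt0 (Wpi_exp_range _ _ _ (leq_subr _ _)). Qed.

Lemma expR_Vstar h s : expR (beta * Vstar R S A H P r beta h s) = Wopt (H - h) s.
Proof. by rewrite VstarE expR_Vpi Wpi_pi_opt ?leq_subr. Qed.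

(** The first action is fixed, so only the continuation varies, and by monotonicity [pi_opt] attains
    the supremum. *)
Lemma expR_Qstar h s a : (h < H)%N ->
  expR (beta * Qstar R S A H P r beta h s a) = bellman h (Wopt (H - h.+1)) s a.
Proof.
move=> hH; have h1 := leq_subr h.+1 H.
have b0 pi : 0 < bellman h (W pi (H - h.+1)) s a.
  by apply: exp_range_gt0 (bellman_exp_range _ _ _ _ _ hH (fun s' => Wpi_exp_range pi _ s' h1)).
rewrite /Qstar (sup_policies _ pi_opt) => [|pi].
  rewrite expR_ln_sg; last exact: b0.
  by rewrite /bellman; under eq_bigr do rewrite Wpi_pi_opt//.
apply: ln_sg; try exact: b0.
by apply: bellman_mono => // s'; rewrite (Wpi_pi_opt _ _ h1) Wpi_le_Wopt.
Qed.

(* [psi_beta] up to the sign of [beta] (psi_betaE). *)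
Definition abs_psi : R := if 0 < beta then `|beta|^-1 else expR (`|beta| * H%:R) / `|beta|.

Lemma abs_psi_gt0 : 0 < abs_psi.
Proof.
by rewrite /abs_psi; case: ifP => _; rewrite ?divr_gt0 ?expR_gt0 ?invr_gt0 ?normr_gt0.
Qed.

Lemma psi_betaE : psi_beta R H beta = abs_psi * sg.
Proof.
rewrite /psi_beta /abs_psi /sg; case: (ltgtP beta 0) beta0 => // hb _.
  by rewrite ltr0_sg// ltr0_norm// mulrN1 invrN mulrN opprK.
by rewrite gtr0_sg// gtr0_norm// mulr1.
Qed.

Definition cap : R := (expR (`|beta| * H%:R) - 1) / `|beta|.

(** Makes the surpluses of all steps comparable when weighted like the cascaded gaps. For [beta > 0]
    use [e^(beta x) (e^(beta m) - 1) <= e^(beta H) - 1]; for [beta < 0] bound [e^(beta x)] by 1 and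
    use [e^(-beta H) (1 - e^(beta H)) = e^(-beta H) - 1]. *)
Lemma weighted_range_le (x : R) m : (m <= H)%N -> 0 <= x <= (H - m)%:R ->
  abs_psi * expR (beta * x) * `|expR (beta * m%:R) - 1| <= cap.
Proof.
move=> mH /andP[x0 xm]; rewrite /cap /abs_psi.
have xH : x + m%:R <= H%:R by rewrite -lerBrDr -natrB.
case: (ltgtP beta 0) beta0 => // hb _; last first.
  rewrite gtr0_norm// ger0_norm; last first.
    by rewrite subr_ge0 -[X in X <= _]expR0 ler_expR mulr_ge0// ltW.
  rewrite -mulrA mulrC ler_wpM2r ?invr_ge0 ?(ltW hb)// mulrBr -expRD -mulrDr mulr1.
  apply: lerB; first by rewrite ler_expR ler_pM2l.
  by rewrite -expR0 ler_expR mulr_ge0// ltW.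
rewrite ltr0_norm// ler0_norm; last first.
  by rewrite subr_le0 -[X in _ <= X]expR0 ler_expR mulr_le0_ge0// ltW.
rewrite -!mulrA mulrCA [X in _ <= X]mulrC ler_wpM2l ?invr_ge0 ?oppr_ge0 ?(ltW hb)//.
have -> : expR (- beta * H%:R) - 1 = expR (- beta * H%:R) * (1 - expR (beta * H%:R)).
  by rewrite mulrBr mulr1 -expRD -mulrDl addNr mul0r expR0.
rewrite mulrA opprB; apply: ler_pM; rewrite ?mulr_ge0 ?expR_ge0//.
- by rewrite subr_ge0 -[X in _ <= X]expR0 ler_expR mulr_le0_ge0// ltW.
- by rewrite -[X in _ <= X]mulr1 ler_wpM2l ?expR_ge0// -[X in _ <= X]expR0 ler_expR mulr_le0_ge0// ltW.
- by rewrite lerB// ler_expR ler_nM2l// ler_nat.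
Qed.

Lemma cap_ge : H%:R <= cap.
Proof.
rewrite /cap ler_pdivlMr ?normr_gt0// mulrC lerBrDl; exact: expR_ge1Dx.
Qed.

(** * Cascaded gaps *)

Local Notation gap := (Delta R S A H P r beta).
Local Notation gap_min := (Delta_min R S A H P r beta).

(** [Rprefix] with a plain natural number, so that the full length [h = H] is allowed in
    inductions. *)
Definition prefix_reward (h : nat) (tau : {ffun 'I_H -> S * A}) : R :=
  \sum_(j : 'I_H | (j < h)%N) r j (tau j).1 (tau j).2.

Lemma prefix_reward_bounds h tau : (h <= H)%N -> 0 <= prefix_reward h tau <= h%:R.
Proof.
move=> hH; apply/andP; split.
  by apply: sumr_ge0 => j _; have /andP[] := r01 j (tau j).1 (tau j).2 (ltn_ord j).
have -> : h%:R = \sum_(j : 'I_H | (j < h)%N) 1 :> R.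
  by rewrite -(big_ord_widen H (fun=> 1) hH) sumr_const card_ord.
by apply: ler_sum => j _; have /andP[] := r01 j (tau j).1 (tau j).2 (ltn_ord j).
Qed.

Lemma prefix_rewardS h s a (tau : {ffun 'I_H -> S * A}) (hH : (h < H)%N) :
  prefix_reward h.+1 [ffun j => if j == Ordinal hH then (s, a) else tau j]
  = prefix_reward h tau + r h s a.
Proof.
rewrite /prefix_reward (bigD1 (Ordinal hH)) //= ffunE eqxx addrC; congr (_ + _).
apply: eq_big => [j|j /andP[_ /negPf jh]]; last by rewrite ffunE jh.
by rewrite -val_eqE /= ltnS [RHS]ltn_neqAle andbC.
Qed.

Lemma gapE (h : 'I_H) s a tau : gap h s a tau =
  abs_psi * expR (beta * prefix_reward h tau) *
    (sg * Wopt (H - h) s - sg * bellman h (Wopt (H - h.+1)) s a).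
Proof.
rewrite /Delta psi_betaE expR_Vstar expR_Qstar// /Rprefix -/(prefix_reward h tau).
by rewrite -mulrBr mulrA; congr (_ * _); rewrite mulrAC.
Qed.

Lemma bellman_le_Wopt_ord (h : 'I_H) s a :
  sg * bellman h (Wopt (H - h.+1)) s a <= sg * Wopt (H - h) s.
Proof.
have h1 : (H - h.+1 < H)%N by rewrite subn_ltH.
have := bellman_le_Wopt _ s a h1.
by rewrite subnSK// subKn// ltnW.
Qed.

Lemma gap_ge0 (h : 'I_H) s a tau : 0 <= gap h s a tau.
Proof.
rewrite gapE mulr_ge0// ?subr_ge0 ?bellman_le_Wopt_ord// mulr_ge0 ?expR_ge0//.
exact: ltW abs_psi_gt0.
Qed.

(** Both exponential values lie in the range of [H - h] steps, and the prefix reward fits in the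
    first [h] steps. *)
Lemma gap_le_cap (h : 'I_H) s a tau : gap h s a tau <= cap.
Proof.
have /andP[p0 p1] := prefix_reward_bounds h tau (ltnW (ltn_ord h)).
apply: le_trans (weighted_range_le (prefix_reward h tau) (H - h) (leq_subr _ _) _); last first.
  by rewrite p0 subKn// ltnW.
rewrite gapE ler_wpM2l ?mulr_ge0 ?expR_ge0 ?(ltW abs_psi_gt0)//.
have /andP[_ w1] := Wopt_exp_range (H - h) s (leq_subr _ _).
have /andP[b0 _] : exp_range (H - h.+1).+1 (bellman h (Wopt (H - h.+1)) s a).
  by apply: bellman_exp_range => // s'; apply: Wopt_exp_range; apply: leq_subr.
apply: le_trans (lerB w1 b0) _.
rewrite -[X in _ - X]mulr1 -mulrBr; apply: le_trans (ler_norm _) _.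
by rewrite normrM /sg normr_sg beta0 mul1r.
Qed.

Lemma gap_min_le (h : 'I_H) s a tau : gap h s a tau != 0 -> gap_min <= gap h s a tau.
Proof.
move=> g0; apply: ge_inf; last by exists h, s, a, tau.
by exists 0 => _ [h' [s' [a' [tau' [-> _]]]]]; apply: gap_ge0.
Qed.

(** The infimum of the empty set is 0, so a positive one comes from an actual gap. *)
Lemma gap_min_witness : 0 < gap_min -> exists h s a tau, gap h s a tau != 0.
Proof.
move=> g0; apply: contrapT => nex; move: g0; rewrite /Delta_min.
set D := (X in inf X); suff -> : D = set0 by rewrite inf0 ltxx.
rewrite -subset0 => d [h [s [a [tau [dE d0]]]]]; apply: nex.
by exists h, s, a, tau; rewrite -dE.
Qed.

Lemma gap_min_le_cap : 0 < gap_min -> gap_min <= cap.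
Proof.
move=> /gap_min_witness[h [s [a [tau g0]]]].
exact: le_trans (gap_min_le _ _ _ _ g0) (gap_le_cap _ _ _ _).
Qed.

(** With a single action every gap vanishes. The second action later keeps the logarithms of the
    bounds away from 0. *)
Lemma two_actions : 0 < gap_min -> (1 < #|A|)%N.
Proof.
move=> /gap_min_witness[h [s [a [tau]]]]; apply: contraNT; rewrite -leqNgt => A1.
have h1 : (H - h.+1 < H)%N by rewrite subn_ltH.
have AE : tb (fun a => sg * bellman h (Wopt (H - h.+1)) s a) = a.
  by apply: (fintype_le1P A1).
rewrite gapE -[(H - h)%N](subnSK (ltn_ord h)) /= subn_subnS//.
by rewrite AE subrr mulr0.
Qed.

End Planning.

(** * Optimism and per-episode regret on a good history *)

Section GoodHistory.
Variables (R : realType) (S A : finType) (H : nat) (P : nat -> S -> A -> S -> R)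
  (r : nat -> S -> A -> R) (beta : R) (tb : (A -> R) -> A).
Hypothesis beta0 : beta != 0.
Hypothesis P_ge0 : forall h s a s', (h < H)%N -> 0 <= P h s a s'.
Hypothesis P_sum1 : forall h s a, (h < H)%N -> \sum_s' P h s a s' = 1.
Hypothesis r01 : forall h s a, (h < H)%N -> 0 <= r h s a <= 1.
Hypothesis tbP : forall (f : A -> R) (a : A), f a <= f (tb f).
Variables (c : R) (K : nat) (delta : R).
Hypothesis c_ge0 : 0 <= c.

Local Notation sg := (Num.sg beta).
Local Notation W := (Wpi R S A H P r beta).
Local Notation bell := (bellman R S A P r beta).
Local Notation opt := (Wopt R S A H P r beta tb).
Local Notation in_range := (exp_range R beta).
Local Notation apsi := (abs_psi R H beta).
Local Notation cp := (cap R H beta).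

(** The bonus without its range factor ([bonusE]). *)
Definition conf_width (n : nat) : R :=
  c * Num.sqrt (#|S|%:R * ln (2 * #|S|%:R * #|A|%:R * H%:R * K%:R / delta) / n%:R).

(** Surplus relative to the length of the range. An unvisited pair keeps its initial value, whose
    surplus is bounded only by the whole range, hence the value 1 at 0. *)
Definition surplus_rate (n : nat) : R :=
  if n == 0%N then 1 else Num.min 1 (2 * conf_width n).

(** Quantifying over all sets [U] controls the empirical mean of every bounded function at once, in
    particular of the learned values, which depend on the same samples. *)
Definition good_history (hist : seq (episode S A)) : Prop :=
  forall h s a (U : {set S}), (h < H)%N -> (0 < Ncount S A hist h s a)%N ->
  (Ncount S A hist h s a)%:R^-1 * \sum_(e <- hist | (e h).1 == (s, a)) ((e h).2 \in U)%:R
    - \sum_(s' in U) P h s a s' <= conf_width (Ncount S A hist h s a).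

Lemma conf_width_ge0 n : 0 <= conf_width n.
Proof. by rewrite mulr_ge0 ?sqrtr_ge0. Qed.

Lemma surplus_rate_ge0 n : 0 <= surplus_rate n.
Proof.
by rewrite /surplus_rate; case: eqP => // _; rewrite le_min ler01 mulr_ge0 ?conf_width_ge0.
Qed.

Lemma surplus_rate_le1 n : surplus_rate n <= 1.
Proof. by rewrite /surplus_rate; case: eqP => // _; rewrite ge_min lexx. Qed.

Lemma sg_range_width n : sg * (expR (beta * n%:R) - 1) = `|expR (beta * n%:R) - 1|.
Proof.
have : 0 <= sg * (expR (beta * n%:R) - 1).
  by rewrite mulrBr subr_ge0 mulr1 sg_expR_ge1.
move=> h; rewrite -(ger0_norm h) normrM.
by rewrite normr_sg beta0 mul1r.
Qed.

Lemma maxA_tb (f : A -> R) : Defs.maxA R A f = f (tb f).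
Proof.
apply/le_anti/andP; split.
  by apply: ge_sup => [|_ [a _ <-]//]; exists (f (tb f)), (tb f).
by apply: ub_le_sup; [exists (f (tb f)) => _ [a _ <-]|exists (tb f)].
Qed.

(** * Empirical transition laws and the surplus of one backup *)

Variable hist : seq (episode S A).
Local Notation N := (Ncount S A hist).
Local Notation w := (walg R S A r beta hist).
Local Notation Q := (Qstep R S A H r beta c K delta hist).
Local Notation Vh := (Valg R S A H r beta c K delta hist).
Local Notation pol := (alg_policy R S A H r beta c K delta tb hist).

Definition empirical h s a s' : R :=
  (N h s a)%:R^-1 * \sum_(e <- hist | (e h).1 == (s, a)) ((e h).2 == s')%:R.

Lemma sum_empirical h s a (f : S -> R) :
  \sum_s' empirical h s a s' * f s' =
  (N h s a)%:R^-1 * \sum_(e <- hist | (e h).1 == (s, a)) f (e h).2.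
Proof.
under eq_bigr do rewrite -mulrA.
rewrite -mulr_sumr; congr (_ * _).
under eq_bigr do rewrite mulr_suml.
rewrite exchange_big /=; apply: eq_bigr => e _.
rewrite (bigD1 (e h).2) //= eqxx mul1r big1 ?addr0// => s' /negPf.
by rewrite eq_sym => ->; rewrite mul0r.
Qed.

Lemma NcountE h s a : (N h s a)%:R = \sum_(e <- hist | (e h).1 == (s, a)) 1 :> R.
Proof. by rewrite /Ncount -sum1_count natr_sum. Qed.

Lemma empirical_sum1 h s a : (0 < N h s a)%N -> \sum_s' empirical h s a s' = 1.
Proof.
move=> N0; under eq_bigr do rewrite -[empirical _ _ _ _]mulr1.
by rewrite (sum_empirical _ _ _ (fun=> 1)) -NcountE mulVf// pnatr_eq0 -lt0n.
Qed.

Lemma empirical_ge0 h s a s' : 0 <= empirical h s a s'.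
Proof. by rewrite mulr_ge0 ?invr_ge0// sumr_ge0. Qed.

Lemma walgE h Vn s a : w h Vn s a =
  expR (beta * r h s a) * \sum_s' empirical h s a s' * expR (beta * Vn s').
Proof.
rewrite (sum_empirical _ _ _ (fun s' => expR (beta * Vn s'))) mulrCA /walg; congr (_ * _).
by rewrite mulr_sumr; apply: eq_bigr => e _; rewrite -expRD -mulrDr.
Qed.

Lemma bonusE h n : bonus R S A H beta c K delta h n =
  `|expR (beta * (H - h)%:R) - 1| * conf_width n.
Proof. by rewrite /bonus /conf_width mulrCA mulrA. Qed.

(** For [beta < 0] the sign turns the [Num.max] into a [Num.min], so one formula covers both
    branches. *)
Lemma sg_Galg h Vn s a : sg * Galg R S A H r beta c K delta hist h Vn s a =
  Num.min (sg * expR (beta * (H - h)%:R))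
          (sg * w h Vn s a + bonus R S A H beta c K delta h (N h s a)).
Proof.
rewrite /Galg; case: (ltgtP beta 0) beta0 => // hb _.
  by rewrite ltr0_sg// !mulN1r oppr_max opprB addrC.
by rewrite gtr0_sg// !mul1r.
Qed.

Section Step.
Variables (h : nat) (Vn : S -> R) (s : S) (a : A).
Hypothesis hH : (h < H)%N.
Hypothesis Vn_range : forall s', in_range (H - h.+1) (expR (beta * Vn s')).

Let HhS : (H - h = (H - h.+1).+1)%N. Proof. by rewrite subnSK. Qed.

Lemma walg_range : (0 < N h s a)%N -> in_range (H - h) (w h Vn s a).
Proof.
move=> N0; rewrite walgE HhS; apply: (exp_range_step _ _ _ H) => //.
apply: mean_exp_range => // [s'|]; [exact: empirical_ge0|exact: empirical_sum1].
Qed.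

Lemma bellman_Vn_range : in_range (H - h) (bell h (fun s' => expR (beta * Vn s')) s a).
Proof. by rewrite HhS; apply: (bellman_exp_range _ _ _ H). Qed.

Lemma Galg_range : (0 < N h s a)%N ->
  in_range (H - h) (Galg R S A H r beta c K delta hist h Vn s a).
Proof.
move=> N0; have /andP[w0 w1] := walg_range N0; apply/andP.
rewrite sg_Galg le_min ge_min lexx sg_expR_ge1//; split => //=.
by rewrite (le_trans w0)// lerDl bonusE mulr_ge0 ?normr_ge0 ?conf_width_ge0.
Qed.

Lemma expR_Qstep : (0 < N h s a)%N ->
  expR (beta * Q h Vn s a) = Galg R S A H r beta c K delta hist h Vn s a.
Proof.
move=> N0; rewrite /Qstep gtn_eqF// expR_ln_sg//.
exact: (exp_range_gt0 _ _ _ _ _ (Galg_range N0)).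
Qed.

Lemma Qstep_range : in_range (H - h) (expR (beta * Q h Vn s a)).
Proof.
have [N0|N0] := posnP (N h s a); last by rewrite expR_Qstep// Galg_range.
by rewrite /Qstep N0 /= /exp_range lexx sg_expR_ge1.
Qed.

(** Both terms are means of one function [f], under the empirical and the true law, and the range of
    [f] has the length that occurs in the bonus. *)
Lemma walg_deviation : good_history hist -> (0 < N h s a)%N ->
  `|sg * w h Vn s a - sg * bell h (fun s' => expR (beta * Vn s')) s a|
     <= bonus R S A H beta c K delta h (N h s a).
Proof.
move=> good N0.
pose f s' := sg * (expR (beta * r h s a) * expR (beta * Vn s')).
have e1 (p : S -> R) :
    sg * (expR (beta * r h s a) * \sum_s' p s' * expR (beta * Vn s')) = \sum_s' p s' * f s'.
  rewrite !mulr_sumr; apply: eq_bigr => s' _; rewrite /f.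
  by rewrite [in RHS]mulrCA; congr (_ * _); rewrite mulrCA.
rewrite walgE /bellman !e1 bonusE -sg_range_width mulrBr mulr1.
apply: mass_deviation => [||s'|U].
- exact: empirical_sum1.
- exact: P_sum1.
- have /andP[f1 f2] : in_range (H - h) (expR (beta * r h s a) * expR (beta * Vn s')).
    by rewrite HhS; apply: (exp_range_step _ _ _ H).
  by rewrite /f f1.
have -> : \sum_(t in U) empirical h s a t =
    (N h s a)%:R^-1 * \sum_(e <- hist | (e h).1 == (s, a)) ((e h).2 \in U)%:R.
  rewrite -(sum_empirical _ _ _ (fun t => (t \in U)%:R)) big_mkcond /=.
  by apply: eq_bigr => t _; case: (t \in U); rewrite ?mulr1 ?mulr0.
exact: good.
Qed.

(** The bonus dominates the deviation, which gives the lower bound; truncation is harmless since the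
    Bellman value is in range. Deviation plus bonus, or else the whole range, gives the upper
    bound. *)
Lemma surplus_bounds : good_history hist ->
  0 <= sg * expR (beta * Q h Vn s a) - sg * bell h (fun s' => expR (beta * Vn s')) s a
    <= `|expR (beta * (H - h)%:R) - 1| * surplus_rate (N h s a).
Proof.
move=> good; have /andP[b0 b1] := bellman_Vn_range; have /andP[q0 q1] := Qstep_range.
have m1 : sg * expR (beta * Q h Vn s a) - sg * bell h (fun s' => expR (beta * Vn s')) s a
    <= `|expR (beta * (H - h)%:R) - 1|.
  by rewrite -sg_range_width mulrBr mulr1 lerB.
have [N0|N0] := posnP (N h s a).
  by rewrite /surplus_rate N0 eqxx mulr1 m1 andbT /Qstep N0 eqxx subr_ge0.
have := walg_deviation good N0; rewrite ler_norml => /andP[d1 d2].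
rewrite /surplus_rate gtn_eqF// minr_pMr// le_min mulr1 m1 /=.
have -> : `|expR (beta * (H - h)%:R) - 1| * (2 * conf_width (N h s a)) =
    2 * bonus R S A H beta c K delta h (N h s a) by rewrite mulrCA -bonusE.
rewrite expR_Qstep// sg_Galg subr_ge0 le_min b1 /=.
apply/andP; split; first by move: d1; lra.
rewrite lerBlDr ge_min; apply/orP; right; move: d2; lra.
Qed.

End Step.

Lemma ValgS n s : (n < H)%N ->
  Vh n.+1 s = Q (H - n.+1) (Vh n) s (pol (H - n.+1)%N s).
Proof. by move=> nH /=; rewrite maxA_tb /alg_policy /Qalg subn_subnS. Qed.

Lemma Qstep_le_Valg n s a : (n < H)%N -> Q (H - n.+1) (Vh n) s a <= Vh n.+1 s.
Proof. by move=> nH /=; rewrite maxA_tb; apply: (tbP (Q _ _ s)). Qed.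

Lemma Valg_range n s : (n <= H)%N -> in_range n (expR (beta * Vh n s)).
Proof.
elim: n s => [|n IH] s nH; first by rewrite /exp_range mulr0 expR0 mulr1 lexx.
rewrite ValgS// -[X in in_range X _](subKn nH).
apply: Qstep_range => [|s']; first exact: subn_ltH.
by rewrite subn_subnS// IH// ltnW.
Qed.

Section Episode.
Hypothesis good : good_history hist.

(** Chain monotonicity of the Bellman operator, nonnegativity of the surplus at the optimal action,
    and greediness of the learner. *)
Lemma optimism n s : (n <= H)%N -> sg * opt n s <= sg * expR (beta * Vh n s).
Proof.
elim: n s => [|n IH] s nH; first by rewrite /= mulr0 expR0.
set a := tb (fun a => sg * bell (H - n.+1) (opt n) s a).
have hH := subn_ltH _ _ nH.
apply: (@le_trans _ _ (sg * bell (H - n.+1) (fun s' => expR (beta * Vh n s')) s a)).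
  by apply: (bellman_mono _ _ _ H) => // s'; apply: IH; rewrite ltnW.
apply: (@le_trans _ _ (sg * expR (beta * Q (H - n.+1) (Vh n) s a))).
  have := surplus_bounds _ (Vh n) s a hH _ good => /(_ _)/andP[|+ _].
    by move=> s'; rewrite subn_subnS// Valg_range// ltnW.
  by rewrite subr_ge0.
by rewrite sg_expR// Qstep_le_Valg.
Qed.

Local Notation gap := (Delta R S A H P r beta).
Local Notation gap_min := (Delta_min R S A H P r beta).
Local Notation prefix := (prefix_reward R S A H r).
Hypothesis gap_min_gt0 : 0 < gap_min.
Hypothesis H_gt0 : (0 < H)%N.

Definition visit_cost (h : nat) (s : S) : R := surplus_rate (N h s (pol h s)) ^+ 2.

Local Notation cost := (additive_value R S A H P pol visit_cost).

(** This is [cp^2 / (4 eps)] for [eps = gap_min / (2 H)]. *)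
Definition gap_scale : R := H%:R * cp ^+ 2 / (2 * gap_min).

Lemma gap_scale_ge0 : 0 <= gap_scale.
Proof.
apply: divr_ge0; first by apply: mulr_ge0 => //; apply: sqr_ge0.
by rewrite mulr_ge0// ltW.
Qed.

(* [u <= u^2 / (4 eps) + eps] with [eps = gap_min / (2 H)] plays the role of clipping the
   surpluses: over an episode the constant terms cost at most half of the minimal gap. *)
Lemma optimistic_loss n s x : (n <= H)%N -> 0 <= x <= (H - n)%:R ->
  apsi * expR (beta * x) * (sg * expR (beta * Vh n s) - sg * W pol n s)
  <= gap_scale * cost n s + n%:R * (gap_min / (2 * H%:R)).
Proof.
have eps0 : 0 < gap_min / (2 * H%:R) by rewrite divr_gt0 ?mulr_gt0 ?ltr0n.
elim: n s x => [|n IH] s x nH /andP[x0 xH].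
  by rewrite /= !mulr0 expR0 mulr1 subrr mulr0 mul0r addr0.
have hH := subn_ltH _ _ nH.
set h := (H - n.+1)%N in hH xH *; set a := pol h s.
have hn : (H - h.+1)%N = n by rewrite /h subn_subnS.
have hn1 : (H - h)%N = n.+1 by rewrite /h subKn.
have Vn_range s' : in_range (H - h.+1) (expR (beta * Vh n s')).
  by rewrite hn Valg_range// ltnW.
have /andP[s0 s1] := surplus_bounds h (Vh n) s a hH Vn_range good.
set u := surplus_rate _ in s1.
(* The loss splits at the Bellman image of the learned values: [step1] bounds the surplus of this
   step, [step2] the loss carried over from the next states. *)
have step1 : apsi * expR (beta * x) *
    (sg * expR (beta * Q h (Vh n) s a) - sg * bell h (fun s' => expR (beta * Vh n s')) s a)
    <= gap_scale * visit_cost h s + gap_min / (2 * H%:R).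
  apply: (@le_trans _ _ (cp * u)).
    apply: le_trans (ler_wpM2l _ s1) _.
      by rewrite mulr_ge0 ?expR_ge0 ?(ltW (abs_psi_gt0 _ _ _ _)).
    rewrite mulrA ler_wpM2r ?surplus_rate_ge0// hn1 weighted_range_le// ?x0//.
  apply: le_trans (amgm _ _ _ eps0) _; rewrite lerD2r /gap_scale /visit_cost -/a -/u.
  rewrite le_eqVlt; apply/orP; left; apply/eqP.
  by field; rewrite gt_eqF//= pnatr_eq0 -lt0n.
have step2 : apsi * expR (beta * x) *
    (sg * bell h (fun s' => expR (beta * Vh n s')) s a - sg * bell h (W pol n) s a)
    <= gap_scale * (\sum_s' P h s a s' * cost n s') + n%:R * (gap_min / (2 * H%:R)).
  rewrite -mulrBr bellmanB !mulr_sumr -[n%:R * _]mul1r -[X in _ + X * _](P_sum1 h s a hH).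
  rewrite mulr_suml -big_split /=; apply: ler_sum => s' _.
  have /andP[r0 r1] := r01 h s a hH.
  (* The factor [e^(beta r)] of the Bellman operator joins the weight, moving [x] to
     [x + r h s a]. *)
  have xr : 0 <= x + r h s a <= (H - n)%:R.
    rewrite addr_ge0//= -hn subKn// -natr1 lerD//.
  have := ler_wpM2l (P_ge0 h s a s' hH) (IH s' _ (ltnW nH) xr).
  rewrite [X in _ <= X]mulrDr [_ * (gap_scale * _)]mulrCA; apply: le_trans.
  rewrite le_eqVlt; apply/orP; left; apply/eqP.
  by rewrite [beta * (_ + _)]mulrDr expRD; ring.
have -> : expR (beta * Vh n.+1 s) = expR (beta * Q h (Vh n) s a) by rewrite ValgS.
have := lerD step1 step2; rewrite -mulrDr.
have -> : W pol n.+1 s = bell h (W pol n) s a by [].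
have -> : cost n.+1 s = visit_cost h s + \sum_s' P h s a s' * cost n s' by [].
rewrite -[n.+1%:R]natr1; set X := sg * bell _ _ _ _; move: (sg * bell _ _ _ _) => Y.
by rewrite addrA subrK => /le_trans; apply; rewrite mulrDr mulrDl mul1r; lra.
Qed.

(** If the chosen action has zero gap, the loss passes to the next states. Otherwise the loss is at
    least [gap_min], while optimism and [optimistic_loss] bound it by [gap_scale] times the cost
    plus [gap_min / 2]; the last term is at most half the loss. *)
Lemma true_loss n s tau : (n <= H)%N ->
  apsi * expR (beta * prefix (H - n)%N tau) * (sg * opt n s - sg * W pol n s)
  <= 2 * gap_scale * cost n s.
Proof.
elim: n s tau => [|n IH] s tau nH; first by rewrite /= subrr !mulr0.
have hH := subn_ltH _ _ nH.
have hn : (H - (H - n.+1).+1)%N = n by rewrite subn_subnS.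
set h := (H - n.+1)%N in hH hn *; set a := pol h s.
have hn1 : (H - h)%N = n.+1 by rewrite /h subKn.
have /andP[t0 t1] := prefix_reward_bounds _ _ _ _ _ r01 h tau (ltnW hH).
have psi0 : 0 <= apsi * expR (beta * prefix h tau).
  by rewrite mulr_ge0 ?expR_ge0 ?(ltW (abs_psi_gt0 _ _ _ _)).
have f0 h' s' : 0 <= visit_cost h' s' by exact: sqr_ge0.
have WE : W pol n.+1 s = bell h (W pol n) s a by [].
have W_le : sg * W pol n.+1 s <= sg * bell h (opt n) s a.
  rewrite WE; apply: (bellman_mono _ _ _ H) => // s'.
  by apply: Wpi_le_Wopt => //; apply: ltnW.
have := gapE _ _ _ _ _ _ _ tb beta0 P_ge0 P_sum1 r01 tbP (Ordinal hH) s a tau.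
rewrite /= hn hn1; set g := gap _ _ _ _ => gE.
have [g0|g0] := eqVneq g 0.
  have optE : sg * opt n.+1 s = sg * bell h (opt n) s a.
    apply/eqP; rewrite -subr_eq0; move: gE; rewrite g0 => /esym/eqP.
    by rewrite mulf_eq0 mulf_eq0 (gt_eqF (expR_gt0 _)) (gt_eqF (abs_psi_gt0 R H _ beta0)).
  have step : apsi * expR (beta * prefix h tau) *
      (sg * opt n.+1 s - sg * W pol n.+1 s)
      <= 2 * gap_scale * \sum_s' P h s a s' * cost n s'.
    rewrite optE WE -mulrBr bellmanB; set z := beta * prefix h tau.
    rewrite !mulr_sumr; apply: ler_sum => s' _.
    (* Recording the current pair at step [h] turns the factor [e^(beta r)] into the prefix weight
       at step [h + 1]. *)
    pose tau' := [ffun j => if j == Ordinal hH then (s, a) else tau j].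
    have := ler_wpM2l (P_ge0 h s a s' hH) (IH s' tau' (ltnW nH)).
    have -> : (H - n)%N = h.+1 by rewrite -hn subKn.
    rewrite prefix_rewardS [_ * (2 * gap_scale * _)]mulrCA; apply: le_trans.
    rewrite le_eqVlt; apply/orP; left; apply/eqP.
    rewrite [beta * (_ + _)]mulrDr expRD -/z; ring.
  apply: le_trans step _; apply: ler_wpM2l; first by rewrite mulr_ge0// gap_scale_ge0.
  by rewrite [X in _ <= X]/= lerDr.
have gmin := gap_min_le _ _ _ _ _ _ _ tb beta0 P_ge0 P_sum1 r01 tbP (Ordinal hH) s a tau g0.
have tH : 0 <= prefix h tau <= (H - n.+1)%:R by rewrite t0.
have loss := optimistic_loss n.+1 s _ nH tH.
have loss_ge : gap_min <= apsi * expR (beta * prefix h tau) * (sg * opt n.+1 s - sg * W pol n.+1 s).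
  by apply: (le_trans gmin); rewrite -/g gE ler_wpM2l// lerD2l lerN2.
have loss_le : apsi * expR (beta * prefix h tau) * (sg * opt n.+1 s - sg * W pol n.+1 s)
  <= gap_scale * cost n.+1 s + n.+1%:R * (gap_min / (2 * H%:R)).
  by apply: le_trans loss; rewrite ler_wpM2l// lerD2r optimism.
have half : n.+1%:R * (gap_min / (2 * H%:R)) <= gap_min / 2.
  rewrite mulrA ler_pdivrMr ?mulr_gt0 ?ltr0n//.
  have -> : gap_min / 2 * (2 * H%:R) = H%:R * gap_min by field.
  by rewrite ler_wpM2r ?ler_nat ?(ltW gap_min_gt0).
have -> : 2 * gap_scale * cost n.+1 s = 2 * (gap_scale * cost n.+1 s) by rewrite mulrA.
move: loss_ge loss_le half.
move: (apsi * _ * _) (gap_scale * _) (n.+1%:R * _) => X Y Z; lra.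
Qed.

(** Concavity of [ln], with slope at most 1 for [beta > 0], where the values are at least 1, and at
    most [e^(-beta H)] for [beta < 0], where they are at least [e^(beta H)]. This is the origin of
    the two cases of [abs_psi]. *)
Lemma ln_loss h s (pi : policy S A) : (h <= H)%N ->
  Vstar R S A H P r beta h s - Vpi R S A H P r beta pi h s
  <= apsi * (sg * opt (H - h) s - sg * W pi (H - h) s).
Proof.
move=> hH; have hH' := leq_subr h H.
have Vs := VstarE _ _ _ _ _ _ _ tb beta0 P_ge0 P_sum1 r01 tbP h s.
rewrite Vs /Vpi Wpi_pi_opt//.
have le1 := Wpi_le_Wopt _ _ _ _ _ r beta tb P_ge0 tbP pi (H - h) s hH'.
have or := Wopt_exp_range _ _ _ _ _ _ _ tb beta0 P_ge0 P_sum1 r01 (H - h) s hH'.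
have wr := Wpi_exp_range _ _ _ _ _ _ _ beta0 P_ge0 P_sum1 r01 pi (H - h) s hH'.
have o0 := exp_range_gt0 _ _ beta0 _ _ or; have w0 := exp_range_gt0 _ _ beta0 _ _ wr.
rewrite -mulrBr /abs_psi; move: le1 or wr; rewrite /exp_range.
case: (ltgtP beta 0) beta0 => // hb _; last first.
  rewrite gtr0_sg// gtr0_norm// !mul1r => le1 _ /andP[w1 _].
  rewrite ler_wpM2l ?invr_ge0 ?(ltW hb)//.
  apply: le_trans (lnB_le _ _ _ w0 o0) _.
  by rewrite ler_pdivrMr// ler_peMr// subr_ge0.
rewrite ltr0_sg// ltr0_norm// !mulN1r !lerN2 => le1 /andP[_ o1] _.
have -> : beta^-1 * (ln (opt (H - h) s) - ln (W pi (H - h) s)) =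
   (- beta)^-1 * (ln (W pi (H - h) s) - ln (opt (H - h) s)).
  by rewrite invrN mulNr -mulrN opprB.
rewrite opprK [- _ + _]addrC [_ / - beta]mulrC -mulrA ler_wpM2l ?invr_ge0 ?oppr_ge0 ?(ltW hb)//.
apply: le_trans (lnB_le _ _ _ o0 w0) _.
rewrite mulrC ler_wpM2r ?subr_ge0// mulNr expRN lef_pV2 ?posrE ?expR_gt0//.
apply: le_trans o1; rewrite ler_expR ler_nM2l// ler_nat; exact: leq_subr.
Qed.

Lemma episode_regret s :
  Vstar R S A H P r beta 0 s - Vpi R S A H P r beta pol 0 s
  <= 2 * gap_scale * cost H s.
Proof.
apply: le_trans (ln_loss _ _ _ _) _ => //; rewrite subn0.
(* The prefix of length 0 is empty, so any trajectory will do and its weight is 1. *)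
pose tau : {ffun 'I_H -> S * A} := [ffun=> (s, tb (fun=> 0))].
have := true_loss H s tau (leqnn H).
by rewrite subnn {1}/prefix_reward big_pred0// mulr0 expR0 mulr1.
Qed.

End Episode.
End GoodHistory.

(** * Supermartingales and visit counts *)

Section Concentration.
Variable R : realType.

(** The exponent without its correction is at most 1/2, so [expR_le_quad] applies; the linear term
    has mean 0 and [1 + 2 lam^2 <= e^(2 lam^2)]. *)
Lemma centered_indicator_mgf (T : finType) (p : T -> R) (U : {set T}) (lam : R) :
  (forall t, 0 <= p t) -> \sum_t p t = 1 -> 0 <= lam <= 2^-1 ->
  \sum_t p t * expR (lam * ((t \in U)%:R - \sum_(u in U) p u) - 2 * lam ^+ 2) <= 1.
Proof.
move=> p0 p1 /andP[l0 l1]; set m := \sum_(u in U) p u.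
have mE : m = \sum_t p t * (t \in U)%:R.
  rewrite /m big_mkcond /=; apply: eq_bigr => t _.
  by case: (t \in U); rewrite ?mulr1 ?mulr0.
have m0 : 0 <= m by apply: sumr_ge0.
have m1 : m <= 1.
  rewrite mE -[X in _ <= X]p1; apply: ler_sum => t _.
  by case: (t \in U); rewrite ?mulr1 ?mulr0.
have b t : expR (lam * ((t \in U)%:R - m)) <= 1 + lam * ((t \in U)%:R - m) + 2 * lam ^+ 2.
  have [x0 x1] : -1 <= (t \in U)%:R - m /\ (t \in U)%:R - m <= 1.
    by case: (t \in U) => /=; split; lra.
  apply: le_trans (expR_le_quad _ _ _) _.
    by apply: le_trans l1; rewrite -[X in _ <= X]mulr1 ler_wpM2l.
  rewrite lerD2l ler_wpM2l// exprMn -[X in _ <= X]mulr1 ler_wpM2l ?sqr_ge0//.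
  by rewrite -real_normK ?num_real// expr_le1// ler_norml x0.
under eq_bigr do rewrite expRD mulrA.
rewrite -mulr_suml expRN.
rewrite ler_pdivrMr ?expR_gt0// mul1r.
apply: le_trans (expR_ge1Dx _).
apply: (@le_trans _ _ (\sum_t p t * (1 + lam * ((t \in U)%:R - m) + 2 * lam ^+ 2))).
  by apply: ler_sum => t _; rewrite ler_wpM2l.
have -> : \sum_t p t * (1 + lam * ((t \in U)%:R - m) + 2 * lam ^+ 2) =
    \sum_t (p t * (1 + 2 * lam ^+ 2 - lam * m) + lam * (p t * (t \in U)%:R)).
  by apply: eq_bigr => t _; ring.
by rewrite big_split /= -mulr_suml -mulr_sumr -mE p1; lra.
Qed.

(** Outside [good] the sum of the [Z j] exceeds [#|J| / d], while its mean is at most [#|J|]. *)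
Lemma union_markov (T J : finType) (p : T -> R) (Z : J -> T -> R) (d : R) (good : pred T) :
  0 < d -> (0 < #|J|)%N -> (forall t, 0 <= p t) -> \sum_t p t = 1 ->
  (forall j t, 0 <= Z j t) -> (forall j, \sum_t p t * Z j t <= 1) ->
  (forall t, (forall j, Z j t <= #|J|%:R / d) -> good t) ->
  1 - d <= \sum_(t | good t) p t.
Proof.
move=> d0 J0 p0 p1 Z0 Z1 hgood.
have c0 : 0 < #|J|%:R :> R by rewrite ltr0n.
rewrite lerBlDr -[X in X <= _]p1 (bigID good) /= lerD2l.
have b0 : 0 < #|J|%:R / d by rewrite divr_gt0.
rewrite -(ler_pM2r b0) [X in _ <= X]mulrCA divff ?gt_eqF// mulr1.
apply: (@le_trans _ _ (\sum_t p t * \sum_j Z j t)).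
  rewrite mulr_suml [X in _ <= X](bigID good) /=.
  rewrite -[X in X <= _]add0r lerD//.
    by apply: sumr_ge0 => t _; rewrite mulr_ge0// sumr_ge0.
  apply: ler_sum => t /negP nt; rewrite ler_wpM2l// leNgt; apply/negP => h.
  apply: nt; apply: hgood => j; apply: le_trans (ltW h).
  by rewrite (bigD1 j) //= lerDl sumr_ge0.
under eq_bigr do rewrite mulr_sumr.
rewrite exchange_big /=; apply: le_trans (ler_sum _ (fun j _ => Z1 j)) _.
by rewrite sumr_const.
Qed.

End Concentration.

Section Run.
Variables (R : realType) (S A : finType) (H : nat) (P : nat -> S -> A -> S -> R)
  (r : nat -> S -> A -> R) (beta : R) (tb : (A -> R) -> A).
Hypothesis beta0 : beta != 0.
Hypothesis P_ge0 : forall h s a s', (h < H)%N -> 0 <= P h s a s'.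
Hypothesis P_sum1 : forall h s a, (h < H)%N -> \sum_s' P h s a s' = 1.
Hypothesis r01 : forall h s a, (h < H)%N -> 0 <= r h s a <= 1.
Hypothesis tbP : forall (f : A -> R) (a : A), f a <= f (tb f).
Variables (c : R) (K : nat) (delta : R) (s1 : S).
Hypothesis c_ge0 : 0 <= c.
Hypothesis H_gt0 : (0 < H)%N.

Local Notation alg := (alg_policy R S A H r beta c K delta tb).
Local Notation rate := (surplus_rate R S A H c K delta).
Local Notation N := (Ncount S A).
Local Notation pw := (path_weight R S A P s1).
Local Notation cost hist :=
  (additive_value R S A H P (alg hist) (visit_cost R S A H r beta tb c K delta hist) H s1).
Implicit Types (hist : seq (episode S A)) (e : episode S A).

Definition deviation_step (lam : R) (k h : nat) s a (U : {set S}) hist e : R :=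
  if (size hist < k)%N && ((e h).1 == (s, a))
  then lam * (((e h).2 \in U)%:R - \sum_(u in U) P h s a u) - 2 * lam ^+ 2 else 0.

Definition visit_sum hist e : R := \sum_(j < H) rate (N hist j (e j).1.1 (e j).1.2) ^+ 2.

(** Division by [H] brings [visit_sum] into [[0, 1]], where [expRN_le_half] applies; the halved
    expectation pays for the 1/2 in that lemma. *)
Definition cost_step hist e : R := (cost hist / 2 - visit_sum hist e) / H%:R.

(** Only step [h] matters: write the exponential as a product over all steps with the other factors
    equal to 1. *)
Lemma deviation_step_mgf lam k h s a U hist : (h < H)%N -> 0 <= lam <= 2^-1 ->
  \sum_(x : H.-tuple S) pw (alg hist) 0 H s1 x *
     expR (deviation_step lam k h s a U hist (play S A s1 (alg hist) x)) <= 1.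
Proof.
move=> hH hlam; pose pol := alg hist.
pose g j (st nx : S) : R := if (j == h) && (size hist < k)%N && ((st, pol j st) == (s, a))
  then expR (lam * ((nx \in U)%:R - \sum_(u in U) P h s a u) - 2 * lam ^+ 2) else 1.
under eq_bigr => x _.
  have -> : expR (deviation_step lam k h s a U hist (play S A s1 (alg hist) x)) =
      \prod_(j < H) g (0 + j)%N (nth s1 (s1 :: x) j) (nth s1 x j).
    rewrite (bigD1 (Ordinal hH)) //= big1 ?mulr1.
      rewrite /g add0n eqxx /= /deviation_step playE /=.
      by case: ifP => // _; rewrite expR0.
    by move=> j; rewrite -val_eqE /g add0n /= => /negPf ->.
  over.
apply: (path_prod_le1 _ _ _ _ _ P_ge0) => // [j st nx|j st jH].
  by rewrite /g; case: ifP => // _; apply: expR_ge0.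
rewrite -/pol; case: (boolP ((j == h) && (size hist < k)%N && ((st, pol j st) == (s, a)))).
  move=> cnd; move: (cnd) => /andP[/andP[/eqP jh _] /eqP[sts pa]].
  under eq_bigr => s' _ do rewrite /g cnd.
  rewrite pa sts jh; apply: centered_indicator_mgf => // [t|]; [exact: P_ge0|exact: P_sum1].
move=> /negPf cnd; under eq_bigr => s' _ do rewrite /g cnd mulr1.
by rewrite P_sum1.
Qed.

Lemma deviation_sum e0 lam k h s a U hist :
  history_sum R S A e0 (deviation_step lam k h s a U) hist =
  lam * (\sum_(e <- take k hist | (e h).1 == (s, a)) ((e h).2 \in U)%:R
         - (N (take k hist) h s a)%:R * \sum_(u in U) P h s a u)
  - 2 * lam ^+ 2 * (N (take k hist) h s a)%:R.
Proof.
elim/last_ind: hist => [|hist e IH].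
  by rewrite /history_sum big_ord0 big_nil mul0r mulr0 subrr mulr0 subrr.
rewrite history_sum_rcons IH /deviation_step.
have [hk|hk] := ltnP (size hist) k; last by rewrite -cats1 takel_cat// addr0.
rewrite !take_oversize ?size_rcons// 1?ltnW//= /Ncount -cats1 count_cat big_cat /=.
rewrite big_cons big_nil addn0 natrD.
by case: ifP => _ /=; rewrite ?addr0 ?add0r; ring.
Qed.

Lemma visit_sum_play hist (x : seq S) :
  visit_sum hist (play S A s1 (alg hist) x) =
  \sum_(j < H) visit_cost R S A H r beta tb c K delta hist (0 + j)%N (nth s1 (s1 :: x) j).
Proof. by apply: eq_bigr => j _; rewrite playE. Qed.

Lemma visit_sum_bounds hist e : 0 <= visit_sum hist e <= H%:R.
Proof.
apply/andP; split; first by apply: sumr_ge0 => j _; apply: sqr_ge0.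
rewrite -[X in _ <= X%:R]card_ord -sum1_card natr_sum; apply: ler_sum => j _.
by rewrite expr_le1// ?surplus_rate_le1 ?surplus_rate_ge0.
Qed.

(** For [y = visit_sum / H], the mean of [e^(-y)] is at most [1 - E[y] / 2 <= e^(-E[y] / 2)], and
    [v] is [E[y] / 2]. *)
Lemma cost_step_mgf hist :
  \sum_(x : H.-tuple S) pw (alg hist) 0 H s1 x *
     expR (cost_step hist (play S A s1 (alg hist) x)) <= 1.
Proof.
have HR : 0 < H%:R :> R by rewrite ltr0n.
pose v := cost hist / (2 * H%:R).
have e1 (x : seq S) : expR (cost_step hist (play S A s1 (alg hist) x)) =
    expR v * expR (- (visit_sum hist (play S A s1 (alg hist) x) / H%:R)).
  by rewrite -expRD /cost_step; congr expR; rewrite /v; field; rewrite gt_eqF.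
under eq_bigr do rewrite e1 mulrCA.
rewrite -mulr_sumr -(ler_pM2l (expR_gt0 (- v))) mulrA -expRD addNr expR0 mul1r mulr1.
apply: le_trans (expR_ge1Dx (- v)).
apply: (@le_trans _ _ (\sum_(x : H.-tuple S) pw (alg hist) 0 H s1 x *
    (1 - (visit_sum hist (play S A s1 (alg hist) x) / H%:R) / 2))).
  apply: ler_sum => x _; apply: ler_wpM2l; first exact: (path_weight_ge0 _ _ _ _ _ P_ge0).
  apply: expRN_le_half.
  have /andP[y0 y1] := visit_sum_bounds hist (play S A s1 (alg hist) x).
  by rewrite divr_ge0//= ler_pdivrMr// mul1r.
have -> : \sum_(x : H.-tuple S) pw (alg hist) 0 H s1 x *
    (1 - (visit_sum hist (play S A s1 (alg hist) x) / H%:R) / 2) =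
  \sum_(x : H.-tuple S) (pw (alg hist) 0 H s1 x - (2 * H%:R)^-1 *
    (pw (alg hist) 0 H s1 x * \sum_(j < H)
      visit_cost R S A H r beta tb c K delta hist (0 + j)%N (nth s1 (s1 :: x) j))).
  apply: eq_bigr => x _; rewrite visit_sum_play.
  by move: (\sum_(j < H) _) => y; field; rewrite gt_eqF.
rewrite sumrB -mulr_sumr (path_additive _ _ _ _ _ P_sum1)//.
by rewrite (path_weight_sum1 _ _ _ _ _ P_sum1)// /v mulrC.
Qed.

(** Counts are taken before the episode, which at each step raises exactly one of them by 1; its
    cost is the next term of that inner sum. *)
Lemma visit_sum_pigeonhole e0 hist :
  history_sum R S A e0 visit_sum hist =
  \sum_(j < H) \sum_(sa : S * A) \sum_(n < N hist j sa.1 sa.2) rate n ^+ 2.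
Proof.
elim/last_ind: hist => [|hist e IH].
  rewrite /history_sum big_ord0 big1// => j _; rewrite big1// => sa _.
  by rewrite big_ord0.
rewrite history_sum_rcons IH -big_split /=; apply: eq_bigr => j _.
case ee : (e j).1 => [s a].
have NS sa : N (rcons hist e) j sa.1 sa.2 = (N hist j sa.1 sa.2 + (sa == (s, a)))%N.
  by rewrite /Ncount -cats1 count_cat /= addn0 ee -surjective_pairing eq_sym.
rewrite (bigD1 (s, a)) //= [RHS](bigD1 (s, a)) //= addrAC; congr (_ + _).
  by rewrite (NS (s, a)) eqxx addn1 big_ord_recr.
by apply: eq_bigr => sa /negPf sane; rewrite NS sane addn0.
Qed.

Lemma visit_sum_total e0 hist : (size hist <= K)%N ->
  history_sum R S A e0 visit_sum hist
  <= H%:R * (#|S|%:R * #|A|%:R) * \sum_(n < K) rate n ^+ 2.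
Proof.
move=> hK; rewrite visit_sum_pigeonhole.
apply: (@le_trans _ _ (\sum_(j < H) \sum_(sa : S * A) \sum_(n < K) rate n ^+ 2)).
  apply: ler_sum => j _; apply: ler_sum => sa _.
  have NK : (N hist j sa.1 sa.2 <= K)%N by apply: leq_trans hK; apply: count_size.
  rewrite (big_ord_widen _ (fun n => rate n ^+ 2) NK) big_mkcond /=.
  by apply: ler_sum => n _; case: ifP => // _; apply: sqr_ge0.
by rewrite !sumr_const card_ord card_prod -mulrnA [(_ * H)%N]mulnC -[X in X <= _]mulr_natl !natrM.
Qed.

End Run.

(** * The regret bounds *)

Section Constants.
Variable R : realType.

(* For l > n the deviation is at most 1 <= sqrt (l / n) for free, so the rate may vanish; this
   keeps it below 1/2, as centered_indicator_mgf requires. *)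
Definition deviation_rate (l : R) (n : nat) : R :=
  if l <= n%:R then Num.sqrt (l / n%:R) / 2 else 0.

Lemma deviation_rate_bounds l n : 0 <= l -> 0 <= deviation_rate l n <= 2^-1.
Proof.
move=> l0; rewrite /deviation_rate; case: ifP => [ln|_]; last by rewrite lexx /= invr_ge0 ler0n.
rewrite divr_ge0 ?sqrtr_ge0//= -[X in _ <= X]mul1r ler_wpM2r ?invr_ge0//.
rewrite -[X in _ <= X]sqrtr1 ler_sqrt//.
case: n ln => [|n] ln; first by rewrite mulr0n invr0 mulr0.
by rewrite ler_pdivrMr ?ltr0n// mul1r.
Qed.

(** With [z = sqrt (l / n)] and rate [z / 2] the hypothesis reads [z X / 2 - n z^2 / 2 <= n z^2],
    that is [X <= 3 n z]. If [l > n], then [X / n <= 1 <= z]. *)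
Lemma deviation_inversion l (n : nat) X : 0 < l -> (0 < n)%N -> X <= n%:R ->
  deviation_rate l n * X - 2 * deviation_rate l n ^+ 2 * n%:R <= l ->
  n%:R^-1 * X <= 3 * Num.sqrt (l / n%:R).
Proof.
move=> l0 n0 Xn; have nR : 0 < n%:R :> R by rewrite ltr0n.
have z0 : 0 < Num.sqrt (l / n%:R) by rewrite sqrtr_gt0 divr_gt0.
have zz : Num.sqrt (l / n%:R) ^+ 2 = l / n%:R by rewrite sqr_sqrtr// ltW// divr_gt0.
have lE : l = n%:R * Num.sqrt (l / n%:R) ^+ 2 by rewrite zz; field; rewrite gt_eqF.
rewrite /deviation_rate => hyp; rewrite [Y in Y <= _]mulrC ler_pdivrMr//; move: hyp; case: ifP => [_|/negbT].
  move: (Num.sqrt _) z0 zz lE => z z0 zz -> h.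
  rewrite -(ler_pM2l z0) -(ler_pM2r (_ : 0 < 2^-1)) ?invr_gt0//.
  by move: h; lra.
rewrite -ltNge => nl _; apply: le_trans Xn _; rewrite ler_peMl ?(ltW nR)//.
have : 1 <= Num.sqrt (l / n%:R).
  by rewrite -[X in X <= _]sqrtr1 ler_sqrt ?divr_ge0 ?(ltW l0)// ler_pdivlMr// mul1r ltW.
by lra.
Qed.

(** [LL] is the logarithm of the final bound, [L] that of the bonus, [l] that of the union bound,
    and [Q] the total of the squared rates. The numbers: [144 * 6 + 4 = 868], [868 + 12 = 880], and
    [2 * 880 <= 2000]. *)
Lemma regret_constant (s a h l Q L LL lK G : R) :
  1 <= s -> 1 <= a -> 1 <= h -> 2^-1 <= LL -> L <= 2 * LL -> 0 <= L -> 0 <= lK <= LL ->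
  l <= 3 * s * L -> Q <= 1 + 144 * s * L * (1 + lK) -> 0 <= G ->
  2 * h ^+ 2 * G * (s * a * Q + l) <= 2000 * (G * h ^+ 3 * s ^+ 2 * a) * LL ^+ 2.
Proof.
move=> s1 a1 h1 LL1 LLL L0 /andP[lK0 lK1] ll QQ G0.
have s0 : 0 <= s by lra.
have a0 : 0 <= a by lra.
have h0 : 0 <= h by lra.
have LL0 : 0 <= LL by lra.
have q1 : 1 <= 4 * LL ^+ 2 by nra.
have sL : s * L <= 2 * (s * LL) by nra.
have LK : L * (1 + lK) <= 6 * LL ^+ 2.
  apply: (@le_trans _ _ ((2 * LL) * (3 * LL))); last by rewrite expr2; lra.
  by apply: ler_pM => //; lra.
have Q1 : Q <= 868 * (s * LL ^+ 2).
  apply: (le_trans QQ).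
  have : s * (L * (1 + lK)) <= s * (6 * LL ^+ 2) by rewrite ler_wpM2l.
  have : 1 <= s * (4 * LL ^+ 2) by rewrite -[X in X <= _]mulr1 ler_pM.
  by lra.
have l1 : l <= 12 * (s * LL ^+ 2).
  apply: (le_trans ll).
  have : s * LL <= s * (2 * LL ^+ 2) by rewrite ler_wpM2l//; nra.
  by lra.
have sa1 : 1 <= s * a by rewrite -[X in X <= _]mulr1 ler_pM.
have X0 : 0 <= s * LL ^+ 2 by rewrite mulr_ge0 ?sqr_ge0.
have l2 : l <= s * a * (12 * (s * LL ^+ 2)).
  by apply: (le_trans l1); rewrite -[X in X <= _]mul1r ler_wpM2r// mulr_ge0.
have t1 : s * a * Q + l <= 880 * (s ^+ 2 * a * LL ^+ 2).
  have : s * a * Q <= s * a * (868 * (s * LL ^+ 2)) by rewrite ler_wpM2l ?mulr_ge0.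
  by move: l2; lra.
have Y0 : 0 <= G * (s ^+ 2 * a * LL ^+ 2) by rewrite !mulr_ge0 ?sqr_ge0.
apply: (@le_trans _ _ (2 * h ^+ 2 * G * (880 * (s ^+ 2 * a * LL ^+ 2)))).
  by rewrite ler_wpM2l// !mulr_ge0 ?sqr_ge0.
have h23 : h ^+ 2 <= h ^+ 3 by rewrite exprS ler_peMl ?sqr_ge0.
have : h ^+ 2 * (G * (s ^+ 2 * a * LL ^+ 2)) <= h ^+ 3 * (G * (s ^+ 2 * a * LL ^+ 2)).
  by rewrite ler_wpM2r.
have : 0 <= h ^+ 3 * (G * (s ^+ 2 * a * LL ^+ 2)) by rewrite mulr_ge0 ?exprn_ge0.
by lra.
Qed.

End Constants.

Section RegretBound.
Variables (R : realType) (S A : finType) (H K : nat) (P : nat -> S -> A -> S -> R)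
  (r : nat -> S -> A -> R) (s1 : S) (beta : R) (tb : (A -> R) -> A).
Hypothesis H_gt0 : (0 < H)%N.
Hypothesis K_gt0 : (0 < K)%N.
Hypothesis beta0 : beta != 0.
Hypothesis P_ge0 : forall h s a s', (h < H)%N -> 0 <= P h s a s'.
Hypothesis P_sum1 : forall h s a, (h < H)%N -> \sum_s' P h s a s' = 1.
Hypothesis r01 : forall h s a, (h < H)%N -> 0 <= r h s a <= 1.
Hypothesis tbP : forall (f : A -> R) (a : A), f a <= f (tb f).
Local Notation gap_min := (Delta_min R S A H P r beta).
Hypothesis gap_min_gt0 : 0 < gap_min.

Local Notation bnd := ((expR (`|beta| * H%:R) - 1) ^+ 2 * H%:R ^+ 3 * #|S|%:R ^+ 2 * #|A|%:R
               / (`|beta| ^+ 2 * gap_min)).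
Local Notation G := (cap R H beta ^+ 2 / gap_min).

Let S_gt0 : (0 < #|S|)%N. Proof. by apply/card_gt0P; exists s1. Qed.
Let A_gt1 : (1 < #|A|)%N.
Proof. exact: (two_actions _ _ _ _ _ _ _ _ beta0 P_ge0 P_sum1 r01 tbP gap_min_gt0). Qed.

Lemma bndE : bnd = G * H%:R ^+ 3 * #|S|%:R ^+ 2 * #|A|%:R.
Proof. by rewrite /cap; field; rewrite gt_eqF//= normr_eq0. Qed.

(** From [gap_min <= cap] and [1 <= H <= cap]. It lets additive constants be absorbed into the
    bound. *)
Lemma G_ge1 : 1 <= G.
Proof.
have g1 := gap_min_le_cap _ _ _ _ _ _ _ tb beta0 P_ge0 P_sum1 r01 tbP gap_min_gt0.
have c1 : 1 <= cap R H beta by apply: le_trans (cap_ge _ _ _ beta0); rewrite ler1n.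
rewrite ler_pdivlMr// mul1r; apply: (le_trans g1).
by rewrite expr2 ler_peMr//; lra.
Qed.

(* [None] indexes the supermartingale of [cost_step], the others those of [deviation_step] stopped
   at episode k, with the rate tuned to n visits. *)
Definition event_index : finType := option ('I_K * 'I_K * 'I_H * S * A * {set S})%type.

Lemma card_event_index :
  (1 < #|event_index| <= (2 * #|S| * #|A| * H * K) ^ (3 * #|S|))%N.
Proof.
rewrite card_option !card_prod !card_ord -[#|{set S}|]cardsT -powersetT card_powerset cardsT.
have A0 : (0 < #|A|)%N by apply: ltnW.
apply/andP; split; first by rewrite ltnS !muln_gt0 K_gt0 H_gt0 S_gt0 A0 expn_gt0.
set B := (2 * #|S| * #|A| * H * K)%N.
have B2 : (1 < B)%N.
  by rewrite /B -!mulnA leq_pmulr// !muln_gt0 S_gt0 A0 H_gt0.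
(* The scalar indices and [None] cost [B^2], the sets cost [2^S <= B^S], and [2 + S <= 3 S]. The
   sets account for the factor [S] under the root of the bonus. *)
apply: (@leq_trans (B ^ 2 * 2 ^ #|S|)).
  have X0 : (0 < K * K * H * #|S| * #|A| * 2 ^ #|S|)%N.
    by rewrite !muln_gt0 K_gt0 H_gt0 S_gt0 A0 expn_gt0.
  apply: (@leq_trans (2 * (K * K * H * #|S| * #|A|) * 2 ^ #|S|)).
    by rewrite -!mulnA mul2n -addnn !mulnA -addn1 leq_add2l.
  rewrite leq_mul2r; apply/orP; right.
  have : (1 <= H * #|S| * #|A|)%N by rewrite !muln_gt0 H_gt0 S_gt0.
  rewrite /B; set hsa := (H * #|S| * #|A|)%N => h1.
  have -> : (2 * (K * K * H * #|S| * #|A|) = 2 * (K * K * hsa))%N by rewrite /hsa; lia.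
  have -> : ((2 * #|S| * #|A| * H * K) ^ 2 = 4 * (K * K * hsa * hsa))%N.
    by rewrite /hsa expnS expn1; lia.
  apply: leq_mul => //; exact: leq_pmulr.
have -> : (3 * #|S| = 2 * #|S| + #|S|)%N by lia.
rewrite expnD; apply: leq_mul; last by rewrite leq_exp2r.
by rewrite expnM -[X in (X <= _)%N]expn1 leq_pexp2l// expn_gt0 (ltnW B2).
Qed.

Section Confidence.
Variable delta : R.
Hypothesis delta01 : 0 < delta <= 1.

Local Notation l := (ln (#|event_index|%:R / delta)).
Local Notation L := (ln (2 * #|S|%:R * #|A|%:R * H%:R * K%:R / delta)).
Local Notation LL := (ln (H%:R * #|S|%:R * #|A|%:R * K%:R / delta)).
Local Notation alg := (alg_policy R S A H r beta 6 K delta tb).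
Local Notation rate := (surplus_rate R S A H 6 K delta).

Let delta_gt0 : 0 < delta. Proof. by case/andP: delta01. Qed.
Let delta_le1 : delta <= 1. Proof. by case/andP: delta01. Qed.

Let card_gt0R : [/\ 0 < #|S|%:R :> R, 0 < #|A|%:R :> R, 0 < H%:R :> R & 0 < K%:R :> R].
Proof. by split; rewrite ltr0n// ltnW. Qed.

Lemma size_ge2 : 2 <= H%:R * #|S|%:R * #|A|%:R * K%:R :> R.
Proof.
rewrite -!natrM ler_nat -[X in (X <= _)%N]mul1n -[X in (X <= _)%N]muln1.
by rewrite leq_mul ?leq_mul// muln_gt0 H_gt0.
Qed.

Lemma LL_ge_half : 2^-1 <= LL.
Proof.
apply: (le_trans (ln2_ge_half R)); apply: ler_ln_wpos => //.
apply: (le_trans size_ge2); rewrite ler_pdivlMr// ler_piMr//.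
by apply: le_trans size_ge2.
Qed.

Lemma L_le : L <= 2 * LL.
Proof.
have [S0 A0 H0 K0] := card_gt0R.
have X0 : 0 < H%:R * #|S|%:R * #|A|%:R * K%:R / delta by rewrite divr_gt0// !mulr_gt0.
have -> : 2 * #|S|%:R * #|A|%:R * H%:R * K%:R / delta =
  2 * (H%:R * #|S|%:R * #|A|%:R * K%:R / delta) by ring.
rewrite lnM ?posrE//; suff : ln 2 <= LL by lra.
apply: ler_ln_wpos => //; apply: (le_trans size_ge2).
by rewrite ler_pdivlMr// ler_piMr// (le_trans _ size_ge2).
Qed.

Lemma L_ge0 : 0 <= L.
Proof.
apply: ln_ge0; rewrite ler_pdivlMr// mul1r; apply: (le_trans delta_le1).
have -> : 2 * #|S|%:R * #|A|%:R * H%:R * K%:R =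
  2 * (H%:R * #|S|%:R * #|A|%:R * K%:R) :> R by ring.
by have := size_ge2; lra.
Qed.

Lemma lnK_bounds : 0 <= (ln K%:R : R) <= LL.
Proof.
have [S0 A0 H0 K0] := card_gt0R.
rewrite ln_ge0 ?ler1n//=; apply: ler_ln_wpos => //.
rewrite ler_pdivlMr//; apply: (@le_trans _ _ K%:R); first by rewrite ler_piMr// ltW.
by rewrite ler_peMl ?(ltW K0)// -!natrM ler1n !muln_gt0 H_gt0 S_gt0 ltnW.
Qed.

Lemma l_le : l <= 3 * #|S|%:R * L.
Proof.
have /andP[i1 i2] := card_event_index.
have [S0 A0 H0 K0] := card_gt0R.
rewrite -natrM -lnXn_nat; last by rewrite divr_gt0// !mulr_gt0.
apply: ler_ln_wpos; first by rewrite divr_gt0// ltr0n ltnW.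
rewrite exprMn exprVn; apply: ler_pM => //.
- by rewrite invr_ge0 ltW.
- by rewrite -!natrM -natrX ler_nat.
- by rewrite lef_pV2 ?posrE ?exprn_gt0// -[X in _ <= X]expr1 ler_wiXn2l ?(ltW delta_gt0)// muln_gt0.
Qed.

Lemma l_gt0 : 0 < l.
Proof.
have /andP[i1 _] := card_event_index.
apply: ln_gt0; rewrite ltr_pdivlMr// mul1r; apply: (le_lt_trans delta_le1).
by rewrite ltr1n.
Qed.

(** The reason for [c = 6]: [l <= 3 S L <= 2^2 S L], so
    [3 sqrt (l / n) <= 3 * 2 * sqrt (S L / n)]. *)
Lemma width_ge (n : nat) :
  3 * Num.sqrt (l / n%:R) <= conf_width R S A H 6 K delta n.
Proof.
rewrite /conf_width; have -> : 6 = 3 * 2 :> R by ring.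
rewrite -mulrA ler_wpM2l//.
have s2 : Num.sqrt (2 ^+ 2) = 2 :> R by rewrite sqrtr_sqr ger0_norm.
rewrite -[X in _ <= X * _]s2.
rewrite -sqrtrM ?sqr_ge0// ler_wsqrtr// mulrA ler_wpM2r ?invr_ge0//.
apply: (le_trans l_le); have : 0 <= #|S|%:R * L by rewrite mulr_ge0 ?L_ge0.
by lra.
Qed.

Lemma rate_total : \sum_(n < K) rate n ^+ 2 <= 1 + 144 * #|S|%:R * L * (1 + ln K%:R).
Proof.
have SL0 : 0 <= #|S|%:R * L by rewrite mulr_ge0 ?L_ge0.
apply: (@le_trans _ _ (1 + 144 * #|S|%:R * L * \sum_(i < K) i.+1%:R^-1)); last first.
  rewrite lerD2l ler_wpM2l//; last exact: harmonic_le.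
  by move: SL0; lra.
(* The number of terms is separated from the [K] inside [rate]. The term at 0 gives the 1, the
   others have [(2 * 6)^2 = 144]. *)
have gen m : (0 < m)%N -> \sum_(n < m) rate n ^+ 2 <=
    1 + 144 * #|S|%:R * L * \sum_(i < m) i.+1%:R^-1.
  case: m => // m _; rewrite big_ord_recl lerD//.
    by rewrite expr_le1// ?surplus_rate_le1 ?surplus_rate_ge0.
  rewrite big_ord_recr /= mulrDr -[X in X <= _]addr0 lerD//; last first.
    by apply: mulr_ge0; [move: SL0; lra | rewrite invr_ge0].
  rewrite mulr_sumr; apply: ler_sum => i _.
  apply: (@le_trans _ _ ((2 * conf_width R S A H 6 K delta i.+1) ^+ 2)).
    have w0 : 0 <= conf_width R S A H 6 K delta i.+1 by apply: conf_width_ge0.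
    rewrite ler_sqr ?nnegrE ?surplus_rate_ge0//; last by apply: mulr_ge0.
    by rewrite /surplus_rate /= ge_min lexx orbT.
  rewrite /conf_width !exprMn sqr_sqrtr ?divr_ge0//.
  by rewrite le_eqVlt; apply/orP; left; apply/eqP; ring.
exact: gen.
Qed.

Let e0 : episode S A := play S A s1 (alg [::]) [::].
Let rn (w : outcome S H K) : seq (episode S A) :=
  learner_run S A s1 alg (samples S H K w).
Local Notation cost hist :=
  (additive_value R S A H P (alg hist) (visit_cost R S A H r beta tb 6 K delta hist) H s1).
Local Notation vsum := (visit_sum R S A H 6 K delta).
Local Notation cstep := (cost_step R S A H P r beta tb 6 K delta s1).
Local Notation dstep := (deviation_step R S A P).

Let size_rn w : size (rn w) = K.
Proof. by rewrite size_learner_run size_map size_tuple. Qed.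

(** The visit count is random, but it is at most [k < K], hence one of the indices [n], and the
    event whose rate is tuned to it applies. *)
Lemma event_good_history (w : outcome S H K) (k : nat) : (k < K)%N ->
  (forall (k n : 'I_K) (h : 'I_H) s a U,
     history_sum R S A e0 (dstep (deviation_rate R l n) k h s a U) (rn w) <= l) ->
  good_history R S A H P 6 K delta (take k (rn w)).
Proof.
move=> kK ev h s a U hH N0; set n := Ncount _ _ _ _ _ _.
have nk : (n <= k)%N.
  by apply: leq_trans (count_size _ _) _; rewrite size_take size_rn kK.
have nK : (n < K)%N by apply: leq_ltn_trans kK.
have := ev (Ordinal kK) (Ordinal nK) (Ordinal hH) s a U.
rewrite deviation_sum /= -/n; set m := \sum_(u in U) _; set X := \sum_(e <- _ | _) _.
move=> hl; apply: le_trans (width_ge n).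
have nR : 0 < n%:R :> R by rewrite ltr0n.
have -> : n%:R^-1 * X - m = n%:R^-1 * (X - n%:R * m).
  by rewrite mulrBr mulKf// gt_eqF.
apply: deviation_inversion hl => //; first exact: l_gt0.
have m0 : 0 <= m by apply: sumr_ge0 => u _; apply: P_ge0.
rewrite lerBlDr -[X in X <= _]addr0 lerD ?mulr_ge0// /n NcountE.
by apply: ler_sum => e _; case: (_ \in _).
Qed.

(** With [V] the expected and [T] the realised costs, the second event gives [V / 2 - T <= H l] and
    the visit counts give [T <= H S A Q]. *)
Lemma event_regret (C : R) (w : outcome S H K) : 2000 <= C ->
  (forall (k n : 'I_K) (h : 'I_H) s a U,
     history_sum R S A e0 (dstep (deviation_rate R l n) k h s a U) (rn w) <= l) ->
  history_sum R S A e0 cstep (rn w) <= l ->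
  regret R S A H P r beta s1 6 K delta tb w <= C * bnd * LL ^+ 2.
Proof.
move=> C2 ev1 ev2; have [S0 A0 H0 K0] := card_gt0R.
pose gs := gap_scale R S A H P r beta.
have gs0 : 0 <= gs by apply: gap_scale_ge0.
pose V := \sum_(k < K) cost (take k (rn w)).
have reg1 : regret R S A H P r beta s1 6 K delta tb w <= 2 * gs * V.
  rewrite /regret /V mulr_sumr; apply: ler_sum => k _.
  apply: episode_regret => //; exact: event_good_history.
have vs := visit_sum_total R S A H 6 K delta e0 (rn w).
rewrite size_rn in vs; have {}vs := vs (leqnn K).
set T := history_sum _ _ _ _ _ _ in vs.
have V1 : (V / 2 - T) / H%:R <= l.
  apply: le_trans ev2; rewrite le_eqVlt; apply/orP; left; apply/eqP.
  rewrite /history_sum /V /T /history_sum size_rn.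
  by rewrite mulr_suml -sumrB mulr_suml; apply: eq_bigr.
rewrite ler_pdivrMr// in V1.
have Q1 := rate_total; set Q := \sum_(n < K) _ in vs Q1.
have V2 : V <= 2 * H%:R * (#|S|%:R * #|A|%:R * Q + l) by move: vs V1; lra.
apply: (le_trans reg1).
apply: (@le_trans _ _ (2 * H%:R ^+ 2 * G * (#|S|%:R * #|A|%:R * Q + l))).
  apply: (@le_trans _ _ (2 * gs * (2 * H%:R * (#|S|%:R * #|A|%:R * Q + l)))).
    by rewrite ler_wpM2l// mulr_ge0.
  rewrite le_eqVlt; apply/orP; left; apply/eqP.
  by rewrite /gs /gap_scale; field; rewrite gt_eqF.
have G0 : 0 <= G by apply: le_trans G_ge1.
have b0 : 0 <= bnd by rewrite bndE; do 3 (apply: mulr_ge0; last by rewrite ?exprn_ge0).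
apply: (@le_trans _ _ (2000 * bnd * LL ^+ 2)); last first.
  by apply: ler_wpM2r; [exact: sqr_ge0 | apply: ler_wpM2r].
rewrite bndE; apply: (regret_constant _ _ _ _ _ _ L _ (ln K%:R)) => //.
- by rewrite ler1n.
- by rewrite ler1n ltnW.
- by rewrite ler1n.
- exact: LL_ge_half.
- exact: L_le.
- exact: L_ge0.
- exact: lnK_bounds.
- exact: l_le.
Qed.

Lemma high_probability_regret (C : R) : 2000 <= C ->
  1 - delta <= Pr_event R S A H P r beta s1 6 K delta tb
    (fun w => regret R S A H P r beta s1 6 K delta tb w <= C * bnd * LL ^+ 2).
Proof.
move=> C2; have l0 := ltW l_gt0.
have /andP[i1 _] := card_event_index.
pose Z (j : event_index) (w : K.-tuple (H.-tuple S)) : R :=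
  expR (history_sum R S A e0
    (if j is Some (k, n, h, s, a, U) then dstep (deviation_rate R l n) k h s a U else cstep)
    (rn w)).
(* [prob] is convertible to [history_weight] of the run. *)
apply: (union_markov R (K.-tuple (H.-tuple S)) event_index
  (fun w => history_weight R S A H P (rn w)) Z) => //.
- exact: ltnW.
- by move=> w; apply: history_weight_ge0.
- exact: history_weight_sum1.
- by move=> j w; apply: expR_ge0.
- move=> j; apply: exp_supermartingale => // hist.
  case: j => [[[[[[k n] h] s] a] U]|]; last exact: cost_step_mgf.
  by apply: deviation_step_mgf => //; apply: deviation_rate_bounds.
move=> w hw; have q0 : 0 < #|event_index|%:R / delta by rewrite divr_gt0// ltr0n ltnW.
have hl j : ln (Z j w) <= l by apply: ler_ln_wpos; [exact: expR_gt0|exact: hw].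
apply: event_regret => // [k n h s a U|].
  by have := hl (Some (k, n, h, s, a, U)); rewrite expRK.
by have := hl None; rewrite expRK.
Qed.

End Confidence.

(** * From high probability to expectation *)

Lemma Vpi_bounds pi : 0 <= Vpi R S A H P r beta pi 0 s1 <= H%:R.
Proof.
have := Wpi_exp_range _ _ _ _ _ _ _ beta0 P_ge0 P_sum1 r01 pi (H - 0) s1 (leq_subr _ _).
rewrite -expR_Vpi// /exp_range subn0 sg_expR// => /andP[h1 ->]; rewrite andbT.
by rewrite -(sg_expR _ _ beta0) mulr0 expR0 mulr1.
Qed.

Lemma regret_le delta w : regret R S A H P r beta s1 6 K delta tb w <= H%:R * K%:R.
Proof.
rewrite mulr_natr -[K in X in _ <= X]card_ord -sumr_const; apply: ler_sum => k _.
rewrite (VstarE _ _ _ _ _ _ _ tb)//.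
have /andP[_ h1] := Vpi_bounds (pi_opt R S A H P r beta tb).
have /andP[h2 _] := Vpi_bounds (alg_policy R S A H r beta 6 K delta tb
  (take k (run R S A H r beta s1 6 K delta tb (nseqs S H K w)))).
by move: h1 h2; lra.
Qed.

(** The exceptional event has probability at most [delta = 1 / (H K)] and regret at most [H K]
    there, so it adds at most 1. *)
Lemma expected_regret (delta : R) : delta = (H%:R * K%:R)^-1 ->
  Expect R S A H P r beta s1 6 K delta tb (regret R S A H P r beta s1 6 K delta tb)
    <= 10000 * bnd * ln (H%:R * #|S|%:R * #|A|%:R * K%:R) ^+ 2.
Proof.
move=> deltaE.
have HK1 : 1 <= H%:R * K%:R :> R by rewrite -natrM ler1n muln_gt0 H_gt0.
have HK0 : 0 < H%:R * K%:R :> R by apply: lt_le_trans HK1.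
have d01 : 0 < delta <= 1 by rewrite deltaE invr_gt0 HK0 invf_le1.
have hp := high_probability_regret delta d01 2000 (lexx _).
set LL := ln _ in hp; set B := 2000 * _ * _ in hp.
set LH := ln _.
pose p w := prob R S A H P r beta s1 6 K delta tb w.
have p0 w : 0 <= p w by apply: history_weight_ge0.
have p1 : \sum_w p w = 1 by apply: history_weight_sum1.
have b1 : 1 <= bnd.
  rewrite bndE; do 3 (apply: mulr_ege1; last by rewrite ?exprn_ege1 ?ler1n ?(ltnW A_gt1)).
  exact: G_ge1.
have LH2 : 2^-1 <= LH by have := LL_ge_half 1; rewrite ltr01 lexx divr1; apply.
(* Dividing by [delta] multiplies the argument by [H K], at most [H S A K], so it is at most
   squared. *)
have LLH : LL <= 2 * LH.
  have size2 := size_ge2.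
  rewrite /LL /LH -lnXn_nat; last by apply: lt_le_trans size2.
  have X0 : 0 < H%:R * #|S|%:R * #|A|%:R * K%:R :> R by apply: lt_le_trans size2.
  rewrite deltaE invrK; apply: ler_ln_wpos; first by rewrite mulr_gt0.
  rewrite expr2 ler_pM2l// -!natrM ler_nat.
  by rewrite leq_mul// -mulnA leq_pmulr// muln_gt0 S_gt0 ltnW.
have LL0 : 0 <= LL.
  by apply: le_trans (LL_ge_half delta d01); rewrite invr_ge0.
have b0 : 0 <= bnd by apply: le_trans b1.
have B0 : 0 <= B by apply: mulr_ge0; [apply: mulr_ge0 | apply: sqr_ge0].
have Bad : \sum_(w | ~~ (regret R S A H P r beta s1 6 K delta tb w <= B)) p w <= delta.
  have := p1; rewrite (bigID (fun w => regret R S A H P r beta s1 6 K delta tb w <= B)) /=.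
  by move: hp; rewrite /Pr_event -/(p _); lra.
apply: (@le_trans _ _ (B + 1)).
  rewrite /Expect (bigID (fun w => regret R S A H P r beta s1 6 K delta tb w <= B)) /=.
  apply: lerD.
    apply: (@le_trans _ _ (\sum_w p w * B)); last by rewrite -mulr_suml p1 mul1r.
    rewrite big_mkcond /=; apply: ler_sum => w _; case: ifP => h.
      by rewrite ler_wpM2l ?p0.
    by rewrite mulr_ge0 ?p0.
  apply: (@le_trans _ _ (\sum_(w | ~~ (regret R S A H P r beta s1 6 K delta tb w <= B))
     p w * (H%:R * K%:R))).
    by apply: ler_sum => w _; rewrite ler_wpM2l ?p0 ?regret_le.
  by rewrite -mulr_suml -ler_pdivlMr// mul1r -deltaE.
have LLs : LL ^+ 2 <= 4 * LH ^+ 2.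
  have -> : 4 * LH ^+ 2 = (2 * LH) ^+ 2 by ring.
  by rewrite ler_sqr ?nnegrE// (le_trans LL0).
have q1 : 1 <= 4 * LH ^+ 2 by nra.
have q2 : bnd * LL ^+ 2 <= bnd * (4 * LH ^+ 2) by apply: ler_wpM2l.
have q3 : 1 <= bnd * (4 * LH ^+ 2) by rewrite -[X in X <= _]mulr1 ler_pM.
by move: q2 q3; rewrite /B; move: (bnd) => b; lra.
Qed.

End RegretBound.

Theorem theorem1 :
  forall R : realType, exists c : R, 0 < c /\ exists C : R, 0 < C /\
  forall (S A : finType) (H K : nat) (P : nat -> S -> A -> S -> R)
         (r : nat -> S -> A -> R) (s1 : S) (beta : R) (tb : (A -> R) -> A),
    (0 < H)%N -> (0 < K)%N -> beta != 0 ->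
    (forall h s a s', (h < H)%N -> 0 <= P h s a s') ->
    (forall h s a, (h < H)%N -> \sum_(s' : S) P h s a s' = 1) ->
    (forall h s a, (h < H)%N -> 0 <= r h s a <= 1) ->
    (forall (f : A -> R) (a : A), f a <= f (tb f)) ->
    0 < Delta_min R S A H P r beta ->
    let bnd := (expR (`|beta| * H%:R) - 1) ^+ 2 * H%:R ^+ 3 * #|S|%:R ^+ 2 * #|A|%:R
               / (`|beta| ^+ 2 * Delta_min R S A H P r beta) in
    (forall delta : R, 0 < delta <= 1 ->
       1 - delta <=
       Pr_event R S A H P r beta s1 c K delta tb
         (fun w => regret R S A H P r beta s1 c K delta tb w
                   <= C * bnd * ln (H%:R * #|S|%:R * #|A|%:R * K%:R / delta) ^+ 2))
    /\
    Expect R S A H P r beta s1 c K (H%:R * K%:R)^-1 tb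
           (regret R S A H P r beta s1 c K (H%:R * K%:R)^-1 tb)
      <= C * bnd * ln (H%:R * #|S|%:R * #|A|%:R * K%:R) ^+ 2.
Proof.
(* The bonus constant comes from [width_ge]. In expectation [2000 * 4] plus 4 for the exceptional
   event is needed, which 10000 covers. *)
move=> R; exists 6; split => //; exists 10000; split => //.
move=> S A H K P r s1 beta tb H0 K0 beta0 P0 P1 r01 tbP gap0 bnd; split; last first.
  exact: expected_regret.
by move=> delta d01; apply: high_probability_regret => //; rewrite ler_nat.
Qed.
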